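(* Let $Q(x,y)=ax^2+hxy+by^2$ be an indefinite integer binary quadratic form not representing zero, with $a>0$, $b>0$, $c:=a+b+h>0$ and $h<0$. Let $D=h^2-4ab$, let $\alpha=\frac{-h+\sqrt{D}}{2a}$ be the dominant (maximal modulus) root of $Q(\alpha,1)=0$, let $\overline{\alpha}=\frac{-h-\sqrt{D}}{2a}$ be the other root, and let $$\alpha=[a_0,a_1,\ldots,a_k,\overline{b_1,\ldots,b_l}],\qquad k\ge 0,\ a_k\neq b_l,$$ be the continued fraction expansion of $\alpha$. With the terminology of the context: (i) The expansion of $\alpha$ describes the unique path $\gamma_\alpha$ that goes from the initial vertex $V_Q$ to the Conway river of $Q$ and then along the river towards $\alpha$. Similarly, the path $\gamma_{\overline{\alpha}}$ goes from $V_Q$ to the river and then along the river towards $\overline{\alpha}$; it is described by the expansion of $\overline{\alpha}$, namely $\overline{\alpha}=[a_0,\ldots,a_{k-1}-1,1,b_l-a_k-1,\overline{b_{l-1},\ldots,b_1,b_l}]$ if $k\ge1$ and $a_k<b_l$; $\overline{\alpha}=[a_0,\ldots,a_{k-1},a_k-b_l-1,1,b_{l-1}-1,\overline{b_{l-2},\ldots,b_1,b_l,b_{l-1}}]$ if $k\ge 0$ and $a_k>b_l$; $\overline{\alpha}=-[b_l-a_0,\overline{b_{l-1},\ldots,b_1,b_l}]$ if $k=0$ and $a_0<b_l$. (ii) The Conway river of $Q$ is a path, infinite in both directions, from $\overline{\alpha}$ to $\alpha$, described by the periodic part $[\overline{b_1,\ldots,b_l}]$: its bi-infinite sequence of turns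 consists of alternating blocks of left turns and right turns whose successive lengths, in the direction towards $\alpha$, form the bi-infinite periodic sequence $\ldots,b_1,\ldots,b_l,b_1,\ldots,b_l,\ldots$. (iii) The finite path $\pi$ from $V_Q$ to the Conway river is given, for $k\ge 1$, by $$\pi=\begin{cases}[a_0,\ldots,a_{k-1},a_k-b_l-1] & \text{if } a_k>b_l,\\ [a_0,\ldots,a_{k-2},a_{k-1}-1] & \text{if } a_k<b_l,\end{cases}$$ and, for $k=0$, by $$\pi=\begin{cases}[a_0-b_l-1] & \text{if } a_0>b_l,\\ \emptyset & \text{if } a_0<b_l.\end{cases}$$
   Context: Continued fractions: $[c_0,c_1,c_2,\ldots]=c_0+\cfrac{1}{c_1+\cfrac{1}{c_2+\cdots}}$, with $c_0\ge0$ and $c_i\geq1$ for $i\ge 1$ integers in genuine expansions; an overline denotes a periodically repeated block. Zero entries are also allowed and are removed by $[\ldots,c_i,0,c_{i+1},\ldots]=[\ldots,c_i+c_{i+1},\ldots]$. Indices of the $b_j$ are read cyclically modulo $l$, and each displayed period of $\overline{\alpha}$ has length $l$. Topograph. A lax vector is a pair $\pm v$ with $v\in\mathbb{Z}^2$ primitive. A superbase is a triple of lax vectors $(\pm e_1,\pm e_2,\pm e_3)$ with $(e_1,e_2)$ a basis of $\mathbb{Z}^2$ and $e_1+e_2+e_3=0$. Each basis $\{\pm u,\pm v\}$ lies in exactly two superbases, obtained by adding $\pm(u+v)$ and $\pm(u-v)$ respectively. This gives an infinite trivalent tree embedded in the plane: vertices are superbases, edges are bases (up to sign), and the complementary regions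 correspond to lax vectors. The topograph of $Q$ is this tree with each region $\pm v$ labelled by $Q(v)$. The initial vertex $V_Q$ is the superbase $\pm(1,0),\pm(0,1),\pm(1,1)$, with values $a=Q(1,0)$, $b=Q(0,1)$, $c=Q(1,1)$. Paths. Let $L=\begin{pmatrix}1&1\\0&1\end{pmatrix}$ and $R=\begin{pmatrix}1&0\\1&1\end{pmatrix}$. A matrix $A=\begin{pmatrix} p & q \\ r & s \end{pmatrix}$ that is a product of $L$'s and $R$'s corresponds to the oriented edge between the regions $\pm(p,r)$ and $\pm(q,s)$, ending at the vertex with third region $\pm(p+q,r+s)$; the identity matrix corresponds to the root edge ending at $V_Q$. A left turn replaces $A$ by $AL$ and a right turn replaces $A$ by $AR$. The finite or infinite expansion $[c_0,c_1,c_2,\ldots]$ describes the path starting at $V_Q$ with $c_0$ left turns, then $c_1$ right turns, then $c_2$ left turns, etc.; for irrational $\xi>0$ with expansion $[c_0,c_1,\ldots]$ this is the path $\gamma_\xi$, along which the fractions $p/r$, $q/s$ converge to $\xi$. An infinite path is said to lead to (or go towards) $\xi$ if the ratios $x/y$ of the vectors $\pm(x,y)$ of adjacent regions converge to $\xi$. Conway river. For an indefinite integer form $Q$ not representing zero (i.e. $Q(x,y)\ne0$ for all nonzero $(x,y)\in\mathbb{Z}^2$, equivalently $D>0$ is not a perfect square), the Conway river is the set of edges of the tree separating a region with positive value of $Q$ from a region with negative value; it is known (Conway) to be a unique infinite periodic path. The finite path from $V_Q$ to the river is the part of $\gamma_\alpha$ from $V_Q$ to the first vertex lying on the river. *)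

(* Defs.v *)
From HB Require Import structures.
From mathcomp Require Export all_boot all_order all_algebra.
From mathcomp Require Export all_classical all_reals all_analysis.
Export Order.TTheory GRing.Theory Num.Theory.
Export numFieldNormedType.Exports.
Set Implicit Arguments.
Unset Strict Implicit.
Unset Printing Implicit Defensive.
Local Open Scope classical_set_scope.
Local Open Scope ring_scope.

Section ContinuedFractions.
Variable R : realType.

(* [c_0, ..., c_n] = c_0 + 1 / (c_1 + ...); the innermost term is
   c_n + 0^-1 = c_n, as 0^-1 = 0. *)
Definition cf_fin (s : seq nat) : R :=
  foldr (fun c x => c%:R + x^-1) 0 s.

(* Zero entries need no separate treatment: the nested fractions obey the
   removal rule. *)
Lemma cf_fin_remove0 (s t : seq nat) (c d : nat) :
  cf_fin (s ++ [:: c, 0, d & t]%N) = cf_fin (s ++ (c + d)%N :: t).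
Proof.
by rewrite /cf_fin !foldr_cat /= add0r invrK natrD addrA.
Qed.

(* Used only for sequences c with infinitely many positive entries and finitely
   many zero ones. *)
Definition cf_value (c : nat -> nat) (xi : R) : Prop :=
  (fun n => cf_fin (mkseq c n)) @ \oo --> xi.

Definition genuine (c : nat -> nat) : Prop := forall i, (0 < c i.+1)%N.

End ContinuedFractions.

(* The infinite sequence [pre, tail 0, tail 1, ...]. *)
Definition cf_seq (pre : seq nat) (tail : nat -> nat) (n : nat) : nat :=
  if (n < size pre)%N then nth 0%N pre n else tail (n - size pre)%N.

Definition vec := 'cV[int]_2.

Definition lax (v : vec) : set vec := [set v; - v].

(* The bases of Z^2 are the pairs of columns of the invertible A : 'M[int]_2.
   As an oriented edge, A ends at the superbase obtained by adding u + v and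
   starts at the one obtained by adding u - v, where u, v are its columns.
   Superbases and edges are unordered sets of lax vectors, so A and - A give the
   same ones. *)
Definition edge_of (A : 'M[int]_2) : set (set vec) :=
  [set lax (col 0 A); lax (col 1 A)].

Definition end_vertex (A : 'M[int]_2) : set (set vec) :=
  [set lax (col 0 A); lax (col 1 A); lax (col 0 A + col 1 A)].

Definition start_vertex (A : 'M[int]_2) : set (set vec) :=
  [set lax (col 0 A); lax (col 1 A); lax (col 0 A - col 1 A)].

Definition adjacent (V W : set (set vec)) : Prop :=
  exists A : 'M[int]_2,
    [/\ A \in unitmx, V = start_vertex A & W = end_vertex A].

(* Infinite paths without backtracking; as the topograph is a tree, these are
   the infinite simple paths. *)
Definition tree_path (P : nat -> set (set vec)) : Prop :=
  forall n, adjacent (P n) (P n.+1) /\ P n <> P n.+2.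

Definition initial_vertex : set (set vec) := end_vertex 1%:M.

(* false is the left turn L = (1 1; 0 1), true the right turn R = (1 0; 1 1). *)
Definition turnmx (t : bool) : 'M[int]_2 :=
  if t then 1%:M + delta_mx 1 0 else 1%:M + delta_mx 0 1.

Definition cf_word (s : seq nat) : seq bool :=
  flatten [seq nseq (nth 0%N s j) (odd j) | j <- iota 0 (size s)].

(* The successive vertices of the path [c_0, ..., c_n]; the empty path is the
   one that stays at the initial vertex. *)
Definition cf_path (s : seq nat) : seq (set (set vec)) :=
  [seq end_vertex (\prod_(t <- take n (cf_word s)) turnmx t)
  | n <- iota 0 (size (cf_word s)).+1].

Definition describes (c : nat -> nat) (P : nat -> set (set vec)) : Prop :=
  forall j, let pi := cf_path (mkseq c j) in mkseq P (size pi) = pi.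

Definition is_gamma (R : realType) (xi : R) (P : nat -> set (set vec)) : Prop :=
  exists c : nat -> nat, [/\ genuine c, cf_value c xi & describes c P].

Definition leads_to (R : realType) (P : nat -> set (set vec)) (xi : R) : Prop :=
  forall eps : R, 0 < eps -> \forall n \near \oo, forall v : vec,
    P n (lax v) ->
    v 1 0 != 0 /\ `|(v 0 0)%:~R / (v 1 0)%:~R - xi| < eps.

(* An oriented bi-infinite path: M n is the oriented edge after which the turn
   t n is taken. Determinant 1 (rather than -1) makes L and R the left and the
   right turn, as for the products of L's and R's. *)
Definition oriented_path (M : int -> 'M[int]_2) (t : int -> bool) : Prop :=
  forall n, \det (M n) = 1 /\ M (n + 1) = M n * turnmx (t n).

(* The j-th block of equal turns is t (s j), ..., t (s (j + 1) - 1); d is the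
   type of the turns of the block of index 0. *)
Definition turn_blocks (t : int -> bool) (b : int -> nat) : Prop :=
  exists (s : int -> int) (d : bool),
    (forall j, s (j + 1) = s j + (b j)%:Z) /\
    (forall j i, s j <= i < s (j + 1) -> t i = d (+) odd `|j|%N).

Definition qform (a h b : int) (v : vec) : int :=
  a * v 0 0 ^+ 2 + h * v 0 0 * v 1 0 + b * v 1 0 ^+ 2.

Definition indefinite (Q : vec -> int) : Prop :=
  (exists v, 0 < Q v) /\ (exists v, Q v < 0).

Definition river (Q : vec -> int) : set (set (set vec)) :=
  [set e | exists A : 'M[int]_2,
    [/\ A \in unitmx, e = edge_of A, 0 < Q (col 0 A) & Q (col 1 A) < 0]].

Definition on_river (Q : vec -> int) (V : set (set vec)) : Prop :=
  exists2 e, river Q e & e `<=` V.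

(* The edge joining adjacent vertices V and W is V `&` W. *)
Definition river_path (R : realType) (Q : vec -> int) (xi : R)
    (P : nat -> set (set vec)) : Prop :=
  [/\ tree_path P, P 0%N = initial_vertex, leads_to P xi &
      exists N : nat,
        (forall n, (n < N)%N -> ~ on_river Q (P n)) /\
        (forall n, (N <= n)%N -> river Q (P n `&` P n.+1))].

Definition part_to_river (Q : vec -> int) (P : nat -> set (set vec))
    (pi : seq (set (set vec))) : Prop :=
  exists N : nat,
    [/\ forall n, (n < N)%N -> ~ on_river Q (P n),
        on_river Q (P N) & pi = mkseq P N.+1].

Definition disc (a h b : int) : int := h ^+ 2 - 4 * a * b.

Definition root_plus (R : realType) (a h b : int) : R :=
  ((- h)%:~R + Num.sqrt (disc a h b)%:~R) / (2 * a%:~R).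

Definition root_minus (R : realType) (a h b : int) : R :=
  ((- h)%:~R - Num.sqrt (disc a h b)%:~R) / (2 * a%:~R).

(* Main.v *)
Require Import Defs.
From mathcomp Require Import ring lra zify.
Local Open Scope classical_set_scope.
Local Open Scope ring_scope.

(** Write (xi, 1) = X u + Y v in the basis formed by the columns u, v of an
    edge.  A left turn replaces (X, Y) by (X - Y, Y) and a right turn replaces
    it by (X, Y - X).  The path that keeps X and Y positive therefore runs the
    Euclidean algorithm on (xi, 1) ([euclid], [gamma]): the lengths of its
    blocks of equal turns are the partial quotients of any expansion of xi,
    zero entries included ([quotients_describe]).  For irrational xi > 0 it
    leads to xi ([gamma_leads_to]), and it is the only path from the initial
    vertex to do so, because a path without backtracking stays in the cone
    that it enters, and the cones of the two possible turns only share a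
    rational direction ([gamma_unique]).

    The form factors as Q(x, y) = a (x - alpha y) (x - beta y), beta being the
    other root.  If (X, Y) and (X', Y') are the coordinates of (alpha, 1) and
    (beta, 1) in an edge, then Q takes the values a Y Y' and a X X' at its two
    regions.  So the edge is on the river exactly when one of the two roots,
    but not the other, lies in its cone.  Consequently the paths of alpha and
    beta run together away from the river up to the vertex where they part;
    this vertex is the first one on the river, and both paths follow the river
    from there on ([gamma_river_path], [gamma_part_to_river]).  The path to the
    river is thus the common beginning of two expansions
    ([branching_split]).

    The expansion of beta comes from an argument of Galois.  The conjugates of
    the complete quotients of alpha satisfy the same recursion
    t_j = b_j + 1 / t_(j+1) and the same periodicity.  They cannot all be
    positive, for then beta would have the same expansion as alpha; and once
    negative they stay negative.  Hence they are negative throughout the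
    period ([conj_tails_lt0]), and p_j = - 1 / t_j is positive and satisfies
    p_(j+1) = b_j + 1 / p_j: this is the period read backwards
    ([reversed_tails]).  It is spliced to the common beginning by
    x - 1 / p = (x - 1) + 1 / (1 + 1 / (p - 1))
    ([conj_expands_lt], [conj_expands_gt]).

    For the river as a whole, orient its edges towards alpha: alpha has
    positive coordinates and beta coordinates of opposite signs
    ([downstream]).  Such an edge has only one predecessor of the same kind
    ([downstream_pred]), and the path of alpha eventually enters its cone
    ([downstream_absorbs]); so these edges form one bi-infinite path, which
    covers the river ([river_edges]).  The path with blocks of lengths b_j
    through the edge where the period of alpha begins is made of such edges,
    since at the ends of its blocks the ratios of the coordinates are the
    complete quotients of alpha and their conjugates
    ([bi_infinite_path]). *)

Section Theory.
Set Implicit Arguments.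
Unset Strict Implicit.
Unset Printing Implicit Defensive.

(** * Superbases and their neighbours *)

Section Topograph.
Implicit Types (A B C : 'M[int]_2) (u v w : vec) (t : bool).

Lemma det22 A : \det A = A 0 0 * A 1 1 - A 0 1 * A 1 0.
Proof.
rewrite (expand_det_row _ 0) !big_ord_recl big_ord0 /cofactor !det_mx11 !mxE /=.
have -> : lift 0 0 = 1 :> 'I_2 by apply/val_inj.
have -> : lift 1 0 = 0 :> 'I_2 by apply/val_inj.
by rewrite /= expr0 expr1; ring.
Qed.

Lemma ord2P (P : 'I_2 -> Prop) : P 0 -> P 1 -> forall i, P i.
Proof.
move=> P0 P1 [[|[|//]] lti].
  by rewrite (_ : Ordinal lti = 0) //; apply/val_inj.
by rewrite (_ : Ordinal lti = 1) //; apply/val_inj.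
Qed.

Lemma vecP u v : u 0 0 = v 0 0 -> u 1 0 = v 1 0 -> u = v.
Proof. by move=> e0 e1; apply/colP; apply: ord2P. Qed.

Lemma vecE i :
  ((forall A j, col j A i 0 = A i j) *
  (forall u v, ((u + v) i 0 = u i 0 + v i 0)%R) *
  (forall u, ((- u) i 0 = - u i 0)%R) *
  (forall c u, ((c *: u) i 0 = c * u i 0)%R))%type.
Proof. by do !split=> *; rewrite mxE. Qed.

Lemma turnE A t :
  ((A * turnmx t) 0 0 = A 0 0 + (if t then A 0 1 else 0)) *
  ((A * turnmx t) 1 0 = A 1 0 + (if t then A 1 1 else 0)) *
  ((A * turnmx t) 0 1 = A 0 1 + (if t then 0 else A 0 0)) *
  ((A * turnmx t) 1 1 = A 1 1 + (if t then 0 else A 1 0)).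
Proof.
rewrite -mulmxE !mxE !big_ord_recl !big_ord0.
have -> : lift 0 0 = 1 :> 'I_2 by apply/val_inj.
by case: t; rewrite /turnmx !mxE /=; do !split; ring.
Qed.

Lemma det_turn A t : \det (A * turnmx t) = \det A.
Proof. by rewrite !det22 !turnE; case: t; ring. Qed.

Lemma laxN v : lax (- v) = lax v.
Proof. by rewrite /lax opprK; apply/seteqP; split=> z /= [->|->]; auto. Qed.

Lemma lax_inj u v : lax u = lax v -> u = v \/ u = - v.
Proof. by move=> e; have : lax v u by rewrite -e; left. Qed.

(** By Cramer's rule, these are the coordinates of [v] in the basis formed by
    the columns of [A] when [\det A = 1]. *)
Definition kX A v := A 1 1 * v 0 0 - A 0 1 * v 1 0.
Definition kY A v := A 0 0 * v 1 0 - A 1 0 * v 0 0.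

Lemma coordsK A v : \det A = 1 -> v = kX A v *: col 0 A + kY A v *: col 1 A.
Proof.
rewrite det22 => dA; apply: vecP; rewrite !vecE /kX /kY.
  by rewrite -[LHS]mul1r -dA; ring.
by rewrite -[LHS]mul1r -dA; ring.
Qed.

Lemma mulmx22 A B i j : (A * B) i j = A i 0 * B 0 j + A i 1 * B 1 j.
Proof.
rewrite -mulmxE mxE !big_ord_recl big_ord0 addr0.
by have -> : lift 0 0 = 1 :> 'I_2 by apply/val_inj.
Qed.

Lemma coords_mul C K j : \det C = 1 ->
  kX C (col j (C * K)) = K 0 j /\ kY C (col j (C * K)) = K 1 j.
Proof.
rewrite det22 /kX /kY !vecE !mulmx22 => dC.
by split; rewrite -[RHS]mul1r -dC; ring.
Qed.

(** The coordinates, relative to an edge, of the three regions at its end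
    ([d = 1]) or at its start ([d = -1]). *)
Definition region_coords (x y : int) (d : int) :=
  (x = 1 /\ y = 0) \/ (x = -1 /\ y = 0) \/ (x = 0 /\ y = 1) \/
  (x = 0 /\ y = -1) \/ (x = 1 /\ y = d) \/ (x = -1 /\ y = - d).

Lemma end_vertexP A v : \det A = 1 -> end_vertex A (lax v) ->
  region_coords (kX A v) (kY A v) 1.
Proof.
rewrite det22 => dA; rewrite /region_coords /kX /kY.
by case=> [[]|] /lax_inj[] ->; rewrite !vecE; lia.
Qed.

Lemma start_vertexP A v : \det A = 1 -> start_vertex A (lax v) ->
  region_coords (kX A v) (kY A v) (-1).
Proof.
rewrite det22 => dA; rewrite /region_coords /kX /kY.
by case=> [[]|] /lax_inj[] ->; rewrite !vecE; lia.
Qed.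

Ltac lax_eq := solve
 [ congr lax; apply: vecP; rewrite !vecE; ring
 | rewrite -[RHS]laxN; congr lax; apply: vecP; rewrite !vecE; ring ].
Ltac vertex_eq :=
  let z := fresh "z" in
  apply/seteqP; split=> z /= [[->|->]|->];
  first [ left; left; lax_eq | left; right; lax_eq | right; lax_eq ].

Lemma col_turn A t :
  (col 0 (A * turnmx t) = if t then col 0 A + col 1 A else col 0 A) *
  (col 1 (A * turnmx t) = if t then col 1 A else col 0 A + col 1 A).
Proof.
by split; case: t; apply: vecP; rewrite !vecE !turnE; ring.
Qed.

Lemma start_turn A t : start_vertex (A * turnmx t) = end_vertex A.
Proof.
by rewrite /start_vertex /end_vertex !col_turn; case: t; vertex_eq.
Qed.

(** In coordinates relative to [A], the two columns of an edge that starts at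
    the end vertex of [A] are among the six vectors (1,0), (0,1), (1,1) and
    their opposites, and so is their difference; only three edges are left up
    to signs and order. *)
Lemma neighbour_cases A W : \det A = 1 -> adjacent (end_vertex A) W ->
  W = start_vertex A \/ exists t, W = end_vertex (A * turnmx t).
Proof.
move=> dA [B [_ eAB ->]].
set u := col 0 B; set v := col 1 B.
have /(end_vertexP dA) hu : end_vertex A (lax u) by rewrite eAB; left; left.
have /(end_vertexP dA) hv : end_vertex A (lax v) by rewrite eAB; left; right.
have /(end_vertexP dA) huv : end_vertex A (lax (u - v)) by rewrite eAB; right.
have kXB : kX A (u - v) = kX A u - kX A v by rewrite /kX !vecE; ring.
have kYB : kY A (u - v) = kY A u - kY A v by rewrite /kY !vecE; ring.
rewrite kXB kYB in huv.
rewrite /end_vertex -/u -/v (coordsK u dA) (coordsK v dA) /start_vertex.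
move: hu hv huv; rewrite /region_coords.
case=> [[-> ->]|[[-> ->]|[[-> ->]|[[-> ->]|[[-> ->]|[-> ->]]]]]];
  case=> [[-> ->]|[[-> ->]|[[-> ->]|[[-> ->]|[[-> ->]|[-> ->]]]]]] huv;
  try (exfalso; lia);
  solve [ left; vertex_eq | right; exists true; rewrite !col_turn; vertex_eq
        | right; exists false; rewrite !col_turn; vertex_eq ].
Qed.

Lemma det1_unit A : \det A = 1 -> A \in unitmx.
Proof. by move=> dA; rewrite unitmxE dA unitr1. Qed.

Lemma adjacent_start_end A : \det A = 1 ->
  adjacent (start_vertex A) (end_vertex A).
Proof. by move=> dA; exists A; split=> //; apply: det1_unit. Qed.

(** The new region beyond a turn has coordinates (2,1) or (1,2), which no
    region at the start vertex has. *)
Lemma start_neq_end_turn A t : \det A = 1 ->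
  start_vertex A <> end_vertex (A * turnmx t).
Proof.
move=> dA; set w := col 0 (A * turnmx t) + col 1 (A * turnmx t) => e.
have /(start_vertexP dA) : start_vertex A (lax w) by rewrite e; right.
move: dA; rewrite det22 /region_coords /kX /kY /w !vecE !turnE => dA.
by case: t {w e}; lia.
Qed.

Lemma edge_meet A : \det A = 1 -> start_vertex A `&` end_vertex A = edge_of A.
Proof.
move=> dA; apply/seteqP; split=> z; last first.
  by rewrite /edge_of /start_vertex /end_vertex /=; tauto.
case=> -[//|/= ->] /(end_vertexP dA); rewrite /region_coords /kX /kY !vecE.
by move: dA; rewrite det22; lia.
Qed.

End Topograph.

(** * Products of turns *)

Section Words.
Implicit Types (A B C : 'M[int]_2) (u v w : vec) (t : bool).

Definition mx_of (s : seq bool) : 'M[int]_2 := \prod_(t <- s) turnmx t.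

Lemma mx_of_rcons s t : mx_of (rcons s t) = mx_of s * turnmx t.
Proof. by rewrite /mx_of -cats1 big_cat big_seq1. Qed.

Lemma mx_of_cat s1 s2 : mx_of (s1 ++ s2) = mx_of s1 * mx_of s2.
Proof. by rewrite /mx_of big_cat. Qed.

Lemma det_words A s : \det (A * mx_of s) = \det A.
Proof.
elim/last_ind: s => [|s t IH]; first by rewrite /mx_of big_nil mulr1.
by rewrite mx_of_rcons mulrA det_turn.
Qed.

Lemma mx_of_ge0 s i j : 0 <= mx_of s i j.
Proof.
elim/last_ind: s i j => [|s t IH].
  by rewrite /mx_of big_nil; apply: ord2P; apply: ord2P; rewrite !mxE.
have h00 := IH 0 0; have h01 := IH 0 1; have h10 := IH 1 0; have h11 := IH 1 1.
by rewrite mx_of_rcons; apply: ord2P; apply: ord2P; rewrite turnE; case: t; lia.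
Qed.

Lemma turn_unit t : turnmx t \is a GRing.unit.
Proof. by apply: det1_unit; rewrite -[turnmx t]mul1r det_turn det1. Qed.

(** If one column dominates the other, a turn can be split off and the sum of
    the entries decreases; if neither does, the determinant forces the
    identity.  This recovers the path between two edges whose cones are
    nested. *)
Lemma nonneg_factor A : \det A = 1 -> (forall i j, 0 <= A i j) ->
  exists s, A = mx_of s.
Proof.
have [n] := ubnP `|(A 0 0 + A 0 1 + A 1 0 + A 1 1)%R|%N.
elim: n A => // n IH A sA dA0 A0.
have := dA0; rewrite det22 => dA.
have ge00 := A0 0 0; have ge01 := A0 0 1.
have ge10 := A0 1 0; have ge11 := A0 1 1.
have strip t B : A = B * turnmx t -> (forall i j, 0 <= B i j) ->
    exists s, A = mx_of s.
  move=> AB B0; have dB : \det B = 1 by rewrite -(det_turn B t) -AB.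
  have b00 := B0 0 0; have b01 := B0 0 1.
  have b10 := B0 1 0; have b11 := B0 1 1.
  have dB' := dB; rewrite det22 in dB'.
  have c0 : B 0 0 != 0 \/ B 1 0 != 0.
    case: (eqVneq (B 0 0) 0) => [e0|]; last by left.
    by right; apply/eqP => e1; move: dB'; rewrite e0 e1 mul0r mulr0.
  have c1 : B 0 1 != 0 \/ B 1 1 != 0.
    case: (eqVneq (B 1 1) 0) => [e0|]; last by right.
    by left; apply/eqP => e1; move: dB'; rewrite e0 e1 mul0r mulr0.
  have ltBn : (`|(B 0 0 + B 0 1 + B 1 0 + B 1 1)%R| < n)%N.
    by move: sA; rewrite AB !turnE; case: (t) => sA; lia.
  have [s Bs] := IH B ltBn dB B0.
  by exists (rcons s t); rewrite mx_of_rcons -Bs.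
have inv_entries t : exists2 B : 'M[int]_2, A = B * turnmx t &
    if t then [/\ B 0 0 = A 0 0 - A 0 1, B 1 0 = A 1 0 - A 1 1,
                  B 0 1 = A 0 1 & B 1 1 = A 1 1]
    else [/\ B 0 0 = A 0 0, B 1 0 = A 1 0,
             B 0 1 = A 0 1 - A 0 0 & B 1 1 = A 1 1 - A 1 0].
  exists (A * (turnmx t)^-1); first by rewrite mulrVK // turn_unit.
  have := turnE (A * (turnmx t)^-1) t; rewrite mulrVK ?turn_unit //.
  by case: (t) => -[[[-> ->] ->] ->]; split; ring.
(* the second column dominates: the last turn was a left turn *)
have [h|h] : (A 0 0 <= A 0 1) && (A 1 0 <= A 1 1) \/
  ~~ ((A 0 0 <= A 0 1) && (A 1 0 <= A 1 1)) by case: (_ && _); auto.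
  have [B AB /= [e1 e2 e3 e4]] := inv_entries false; apply: (strip _ _ AB).
  by apply: ord2P; apply: ord2P; rewrite ?e1 ?e2 ?e3 ?e4; lia.
have [h'|h'] : (A 0 1 <= A 0 0) && (A 1 1 <= A 1 0) \/
  ~~ ((A 0 1 <= A 0 0) && (A 1 1 <= A 1 0)) by case: (_ && _); auto.
  have [B AB /= [e1 e2 e3 e4]] := inv_entries true; apply: (strip _ _ AB).
  by apply: ord2P; apply: ord2P; rewrite ?e1 ?e2 ?e3 ?e4; lia.
exists [::]; rewrite /mx_of big_nil.
suff : A 0 0 = 1 /\ A 0 1 = 0 /\ A 1 0 = 0 /\ A 1 1 = 1.
  move=> [e1 [e2 [e3 e4]]].
  by apply/matrixP; apply: ord2P; apply: ord2P; rewrite ?e1 ?e2 ?e3 ?e4 !mxE.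
by nia.
Qed.

End Words.

(** * The path of the Euclidean algorithm *)

Section Euclid.
Variable R : realType.
Implicit Types (A B C : 'M[int]_2) (u v w : vec) (t : bool) (xi eps : R).

(** The coordinates of (xi, 1) in the basis formed by the columns of [A]; the
    vector itself is only defined over the reals, the edge over the
    integers. *)
Definition cX A xi : R := (A 1 1)%:~R * xi - (A 0 1)%:~R.
Definition cY A xi : R := (A 0 0)%:~R - (A 1 0)%:~R * xi.

(** Irrationality, in the form in which it makes integer linear relations
    trivial. *)
Definition irr xi := forall p q : int, p%:~R = q%:~R * xi -> q = 0.

Definition inside A xi : bool := (0 < cX A xi) && (0 < cY A xi).

Lemma cX_turn A t xi :
  cX (A * turnmx t) xi = if t then cX A xi else cX A xi - cY A xi.
Proof. by rewrite /cX /cY !turnE; case: t; rewrite !intrD; ring. Qed.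

Lemma cY_turn A t xi :
  cY (A * turnmx t) xi = if t then cY A xi - cX A xi else cY A xi.
Proof. by rewrite /cX /cY !turnE; case: t; rewrite !intrD; ring. Qed.

Lemma cXY_det A xi : \det A = 1 ->
  cX A xi * (A 1 0)%:~R + cY A xi * (A 1 1)%:~R = 1.
Proof.
rewrite det22 => dA; rewrite /cX /cY.
have : (A 0 0 * A 1 1 - A 0 1 * A 1 0)%:~R = 1 :> R by rewrite dA.
by rewrite intrB !intrM => h; rewrite -[RHS]h; ring.
Qed.

Lemma irr_eq0 xi (p q : int) : irr xi -> p%:~R = q%:~R * xi -> p = 0 /\ q = 0.
Proof.
move=> ix e; have q0 := ix _ _ e; split=> //.
by move: e; rewrite q0 mul0r => /eqP; rewrite intr_eq0 => /eqP.
Qed.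

(** A vanishing coordinate, or two equal ones, would give a rational value of
    [xi]; so the Euclidean algorithm never stops. *)
Lemma irr_coords A xi : irr xi -> \det A = 1 ->
  [/\ cX A xi != 0, cY A xi != 0 & cX A xi != cY A xi].
Proof.
move=> ix; rewrite det22 => dA; rewrite /cX /cY; split; apply/eqP => e.
- have e' : (A 0 1)%:~R = (A 1 1)%:~R * xi by lra.
  by have [h1 h2] := irr_eq0 ix e'; move: dA; rewrite h1 h2; lia.
- have e' : (A 0 0)%:~R = (A 1 0)%:~R * xi by lra.
  by have [h1 h2] := irr_eq0 ix e'; move: dA; rewrite h1 h2; lia.
- have e' : (A 0 0 + A 0 1)%:~R = (A 1 0 + A 1 1)%:~R * xi.
    by rewrite !intrD; lra.
  have [e0 e1] := irr_eq0 ix e'.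
  have a01 : A 0 1 = - A 0 0 by lia.
  have a11 : A 1 1 = - A 1 0 by lia.
  by move: dA; rewrite a01 a11; lia.
Qed.

Definition greedy A xi : bool := cX A xi < cY A xi.

(** The two coordinates determine the turn: after the wrong one, one of them
    is negative. *)
Lemma inside_turn_greedy A t xi : inside (A * turnmx t) xi -> greedy A xi = t.
Proof.
rewrite /inside /greedy cX_turn cY_turn; case: t => /andP[h1 h2]; first by lra.
by apply/negbTE; lra.
Qed.

Lemma inside_turn A t xi : inside (A * turnmx t) xi -> inside A xi.
Proof. by rewrite /inside cX_turn cY_turn; case: t => /andP[h1 h2]; lra. Qed.

Lemma inside_greedy A xi : irr xi -> \det A = 1 -> inside A xi ->
  inside (A * turnmx (greedy A xi)) xi.
Proof.
move=> ix dA; have [_ _ ne] := irr_coords ix dA.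
rewrite /inside /greedy cX_turn cY_turn => /andP[h1 h2].
by case: (ltrgtP (cX A xi) (cY A xi)) ne => //= h _; apply/andP; split; lra.
Qed.

Fixpoint euclid xi n : 'M[int]_2 :=
  if n is m.+1 then euclid xi m * turnmx (greedy (euclid xi m) xi) else 1%:M.

Definition gamma xi n := end_vertex (euclid xi n).

Lemma euclid_det xi n : \det (euclid xi n) = 1.
Proof. by elim: n => [|n IH]; rewrite ?det1 // det_turn. Qed.

Lemma euclid_inside xi n : irr xi -> 0 < xi -> inside (euclid xi n) xi.
Proof.
move=> ix x0; elim: n => [|n IH]; last by apply: inside_greedy (euclid_det _ _) IH.
by rewrite /inside /cX /cY !mxE /=; lra.
Qed.

Lemma gamma_start xi n : gamma xi n = start_vertex (euclid xi n.+1).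
Proof. by rewrite /gamma /= start_turn. Qed.

Lemma gamma_tree_path xi : tree_path (gamma xi).
Proof.
move=> n; rewrite (gamma_start xi n); split.
  exact: adjacent_start_end (euclid_det _ _).
exact: start_neq_end_turn (euclid_det _ _).
Qed.

Lemma gamma_meet xi n : gamma xi n `&` gamma xi n.+1 = edge_of (euclid xi n.+1).
Proof. by rewrite gamma_start /gamma edge_meet // euclid_det. Qed.

Lemma euclid_ge0 xi n i j : 0 <= euclid xi n i j.
Proof.
elim: n i j => [|n IH]; first by apply: ord2P; apply: ord2P; rewrite !mxE.
have h00 := IH 0 0; have h01 := IH 0 1; have h10 := IH 1 0; have h11 := IH 1 1.
by apply: ord2P; apply: ord2P; rewrite /= turnE; case: greedy; lia.
Qed.

Lemma euclid_s_gt0 xi n : 0 < euclid xi n 1 1.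
Proof.
elim: n => [|n IH]; first by rewrite mxE.
have := euclid_ge0 xi n 1 0.
by rewrite /= turnE; case: greedy; lia.
Qed.

(** The entry stays zero only as long as every turn is a left turn. *)
Lemma euclid_r_eq0 xi n : euclid xi n 1 0 = 0 ->
  euclid xi n 1 1 = 1 /\ euclid xi n 0 1 = n%:Z * euclid xi n 0 0 /\ euclid xi n 0 0 = 1.
Proof.
elim: n => [|n IH]; first by rewrite !mxE.
have := euclid_ge0 xi n 1 0; have := euclid_s_gt0 xi n.
rewrite /= !turnE; case: greedy => /= h1 h2 h3; first by lia.
have h4 : euclid xi n 1 0 = 0 by lia.
have [-> [-> e]] := IH h4; rewrite h4 e; split=> //; lia.
Qed.

Lemma euclid_r_gt0 xi n : irr xi -> 0 < xi -> xi < n%:R -> 0 < euclid xi n 1 0.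
Proof.
move=> ix x0 xn; have := euclid_ge0 xi n 1 0.
rewrite le_eqVlt => /orP[/eqP e|//].
have [e1 [e2 e3]] := euclid_r_eq0 (esym e).
have := euclid_inside n ix x0; rewrite /inside /cX e1 e2 e3 mulr1 mulr1z mul1r.
rewrite -pmulrn => /andP[h _].
suff : xi < xi by rewrite ltxx.
by lra.
Qed.

(** After the first right turn both lower entries [r], [s] are at least 1,
    and each turn adds one of them to the other; so [r + s], and with it
    [r * s >= r + s - 1], grows at least linearly.  The first right turn comes
    before step [n], as [n] left turns need [xi > n]. *)
Lemma euclid_growth xi n m : irr xi -> 0 < xi -> xi < n%:R ->
  let A := euclid xi (n + m) in m.+1%:Z <= A 1 0 * A 1 1.
Proof.
move=> ix x0 xn /=.
suff : 0 < euclid xi (n + m) 1 0 /\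
       m.+2%:Z <= euclid xi (n + m) 1 0 + euclid xi (n + m) 1 1.
  by move: (euclid_s_gt0 xi (n + m)); nia.
elim: m => [|m [IH1 IH2]].
  by rewrite addn0; have := euclid_r_gt0 ix x0 xn; have := euclid_s_gt0 xi n; lia.
have := euclid_s_gt0 xi (n + m).
by rewrite addnS /= !turnE; case: greedy; lia.
Qed.

(** Since [X * r + Y * s = 1] ([cXY_det]), the distances of the fractions
    [p / r] and [q / s] from [xi], which are [Y / r] and [X / s], are at most
    [1 / (r * s)]; the fraction of the third region lies between them. *)
Lemma regions_near A xi eps : \det A = 1 -> inside A xi -> 0 < eps ->
  0 < A 1 0 -> 0 < A 1 1 -> 1 < eps * (A 1 0 * A 1 1)%:~R ->
  forall v, end_vertex A (lax v) ->
  v 1 0 != 0 /\ `|(v 0 0)%:~R / (v 1 0)%:~R - xi| < eps.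
Proof.
move=> dA /andP[X0 Y0] e0 r0 s0 he v hv.
have det1R := cXY_det xi dA.
have rR : 0 < (A 1 0)%:~R :> R by rewrite ltr0z.
have sR : 0 < (A 1 1)%:~R :> R by rewrite ltr0z.
rewrite intrM in he.
have hY : cY A xi < eps * (A 1 0)%:~R.
  have : cY A xi * (A 1 1)%:~R <= 1 by nra.
  by rewrite -(ltr_pM2r sR); nra.
have hX : cX A xi < eps * (A 1 1)%:~R.
  have : cX A xi * (A 1 0)%:~R <= 1 by nra.
  by rewrite -(ltr_pM2r rR); nra.
have key u : 0 < u 1 0 -> `|(u 0 0)%:~R - (u 1 0)%:~R * xi| < eps * (u 1 0)%:~R ->
    forall w, lax w = lax u ->
    w 1 0 != 0 /\ `|(w 0 0)%:~R / (w 1 0)%:~R - xi| < eps.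
  move=> u1 hu w hw.
  have u1R : 0 < (u 1 0)%:~R :> R by rewrite ltr0z.
  have fin : `|(u 0 0)%:~R / (u 1 0)%:~R - xi| < eps.
    have -> : (u 0 0)%:~R / (u 1 0)%:~R - xi =
             ((u 0 0)%:~R - (u 1 0)%:~R * xi) / (u 1 0)%:~R.
      by field; rewrite gt_eqF.
    by rewrite normrM normfV (gtr0_norm u1R) ltr_pdivrMr.
  have [->|->] := lax_inj hw; first by rewrite gt_eqF.
  by rewrite !vecE !intrN invrN mulrNN oppr_eq0 gt_eqF.
move: hY hX; rewrite /cX /cY in X0 Y0 *; move=> hY hX.
case: hv => [[]|] hv; apply: key hv; rewrite !vecE ?intrD ?ltr_norml.
- by [].
- by apply/andP; split; lra.
- by [].
- by apply/andP; split; lra.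
- by lia.
- by apply/andP; split; lra.
Qed.

Lemma gamma_leads_to xi : irr xi -> 0 < xi -> leads_to (gamma xi) xi.
Proof.
move=> ix x0 eps e0.
pose n := Num.bound xi; have xn : xi < n%:R by apply: archi_boundP; exact: ltW.
pose m := Num.bound eps^-1.
have hm : eps^-1 < m%:R by apply: archi_boundP; rewrite invr_ge0 ltW.
exists (n + m)%N => // k /= le_k v.
have growth := @euclid_growth xi n (k - n)%N ix x0 xn.
have kE : (n + (k - n) = k)%N by lia.
rewrite kE in growth.
have s0 := euclid_s_gt0 xi k.
apply: regions_near => //.
- exact: euclid_det.
- exact: euclid_inside.
- by move: s0 growth => /=; nia.
rewrite mulrC -ltr_pdivrMr // mul1r; apply: (lt_le_trans hm).
rewrite pmulrn ler_int; apply: le_trans growth; lia.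
Qed.

End Euclid.

(** * Edges traversed backwards *)

Section Reversal.
Implicit Types (A B C : 'M[int]_2) (t : bool).

(** The same edge with its columns [u], [v] replaced by [v], [- u]: this
    exchanges start and end and keeps the determinant 1, so that the words
    left and right keep their meaning. *)
Definition rev_edge A : 'M[int]_2 := A * (delta_mx 1 0 - delta_mx 0 1).

Lemma rev_edgeE A :
  (rev_edge A 0 0 = A 0 1) * (rev_edge A 1 0 = A 1 1) *
  (rev_edge A 0 1 = - A 0 0) * (rev_edge A 1 1 = - A 1 0).
Proof.
rewrite /rev_edge -mulmxE !mxE !big_ord_recl !big_ord0.
have -> : lift 0 0 = 1 :> 'I_2 by apply/val_inj.
by rewrite !mxE /=; do !split; ring.
Qed.

Lemma rev_det A : \det (rev_edge A) = \det A.
Proof. by rewrite !det22 !rev_edgeE; ring. Qed.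

Lemma col_rev A :
  (col 0 (rev_edge A) = col 1 A) * (col 1 (rev_edge A) = - col 0 A).
Proof. by split; apply: vecP; rewrite !vecE !rev_edgeE. Qed.

Lemma end_rev A : end_vertex (rev_edge A) = start_vertex A.
Proof.
rewrite /end_vertex /start_vertex !col_rev laxN -(laxN (col 1 A - _)) opprB.
by rewrite (setUC [set _] [set lax (col 0 A)]).
Qed.

Lemma start_rev A : start_vertex (rev_edge A) = end_vertex A.
Proof.
rewrite /end_vertex /start_vertex !col_rev laxN opprK addrC.
by rewrite (setUC [set _] [set lax (col 0 A)]).
Qed.

Lemma colN A j : col j (- A) = - col j A.
Proof. by apply/colP => i; rewrite !mxE. Qed.

Lemma end_vertexN A : end_vertex (- A) = end_vertex A.
Proof. by rewrite /end_vertex !colN -opprD !laxN. Qed.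

Lemma edge_ofN A : edge_of (- A) = edge_of A.
Proof. by rewrite /edge_of !colN !laxN. Qed.

Lemma edge_rev A : edge_of (rev_edge A) = edge_of A.
Proof. by rewrite /edge_of !col_rev laxN setUC. Qed.

(** Seen backwards, a left turn is a right turn and conversely. *)
Lemma rev_turn A t : rev_edge (A * turnmx t) * turnmx (~~ t) = rev_edge A.
Proof.
by case: t; apply/matrixP; apply: ord2P; apply: ord2P;
  rewrite !turnE !rev_edgeE ?turnE /=; ring.
Qed.

End Reversal.

(** * Uniqueness of the path leading to an irrational number *)

Section Unique.
Variable R : realType.
Implicit Types (A B C K : 'M[int]_2) (t : bool) (xi eps rho : R).
Implicit Types (P : nat -> set (set vec)).

Lemma cX_rev A xi : cX (rev_edge A) xi = cY A xi.
Proof. by rewrite /cX /cY !rev_edgeE !intrN; ring. Qed.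

Lemma cY_rev A xi : cY (rev_edge A) xi = - cX A xi.
Proof. by rewrite /cX /cY !rev_edgeE; ring. Qed.

(** The coordinates depend continuously on [xi], hence keep their signs
    nearby. *)
Lemma coords_stable B xi : cX B xi != 0 -> cY B xi != 0 ->
  exists2 eps : R, 0 < eps & forall rho, `|rho - xi| < eps ->
    0 < cX B rho * cX B xi /\ 0 < cY B rho * cY B xi.
Proof.
move=> X0 Y0.
pose d : R := 1 + `|(B 1 1)%:~R| + `|(B 1 0)%:~R|.
have d0 : 0 < d by rewrite /d; have := normr_ge0 ((B 1 1)%:~R : R);
  have := normr_ge0 ((B 1 0)%:~R : R); lra.
have stable (x y : R) : x != 0 -> `|y| < `|x| -> 0 < (x + y) * x.
  move=> x0; rewrite ltr_norml; case: (ltrgtP x 0) x0 => // hx _.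
    by rewrite ltr0_norm // => /andP[h1 h2]; nra.
  by rewrite gtr0_norm // => /andP[h1 h2]; nra.
(* [d] exceeds the Lipschitz constants of both coordinates. *)
exists (Num.min `|cX B xi| `|cY B xi| / d).
  by rewrite divr_gt0 // lt_min !normr_gt0 X0 Y0.
move=> rho; rewrite ltr_pdivlMr // lt_min => /andP[hX hY].
have n0 := normr_ge0 (rho - xi).
have nr := normr_ge0 ((B 1 0)%:~R : R); have ns := normr_ge0 ((B 1 1)%:~R : R).
split.
- rewrite (_ : cX B rho = cX B xi + (B 1 1)%:~R * (rho - xi)); last first.
    by rewrite /cX; ring.
  by apply: stable => //; rewrite normrM; apply: le_lt_trans hX; rewrite /d; nra.
- rewrite (_ : cY B rho = cY B xi + - (B 1 0)%:~R * (rho - xi)); last first.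
    by rewrite /cY; ring.
  apply: stable => //; rewrite normrM normrN; apply: le_lt_trans hY.
  by rewrite /d; nra.
Qed.

Lemma cX_ratio B (v : vec) : v 1 0 != 0 ->
  cX B ((v 0 0)%:~R / (v 1 0)%:~R : R) * (v 1 0)%:~R = (kX B v)%:~R.
Proof.
move=> v0; rewrite /cX /kX intrB !intrM; field.
by rewrite intr_eq0.
Qed.

Lemma cY_ratio B (v : vec) : v 1 0 != 0 ->
  cY B ((v 0 0)%:~R / (v 1 0)%:~R : R) * (v 1 0)%:~R = (kY B v)%:~R.
Proof.
move=> v0; rewrite /cY /kY intrB !intrM; field.
by rewrite intr_eq0.
Qed.

(** Without backtracking, a path that has crossed [B] can only turn left or
    right. *)
Lemma tree_path_trapped P m B : tree_path P -> \det B = 1 ->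
  P m = start_vertex B -> P m.+1 = end_vertex B ->
  forall i, exists2 s, P (m + i)%N = start_vertex (B * mx_of s) &
                       P (m + i).+1 = end_vertex (B * mx_of s).
Proof.
move=> tP dB sB eB; elim=> [|i [s sK eK]].
  by exists [::]; rewrite /mx_of big_nil mulr1 addn0.
have [adj ne] := tP (m + i)%N; have [adj' _] := tP (m + i).+1.
have dK : \det (B * mx_of s) = 1 by rewrite det_words.
rewrite eK in adj'; have [e|[t e]] := neighbour_cases dK adj'.
  by case: ne; rewrite sK e.
exists (rcons s t); rewrite mx_of_rcons mulrA addnS ?start_turn //.
Qed.

(** All regions seen after crossing [B] have coordinates of the same sign
    relative to [B]; this passes to the limit of their ratios. *)
Lemma trapped_limit P m B xi : tree_path P -> \det B = 1 ->
  P m = start_vertex B -> P m.+1 = end_vertex B -> leads_to P xi ->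
  irr xi -> 0 < cX B xi * cY B xi.
Proof.
move=> tP dB sB eB lead ix.
have [X0 Y0 _] := irr_coords ix dB.
have [eps e0 stable] := coords_stable X0 Y0.
have [n _ near_n] := lead _ e0.
have [s _ es] := tree_path_trapped tP dB sB eB n.
set v := col 0 (B * mx_of s).
have [] := near_n (m + n).+1 _ v.
- by rewrite /=; lia.
- by rewrite es; left; left.
move=> v1 /stable[hX hY].
have k0 : 0 <= kX B v * kY B v.
  have [-> ->] := coords_mul (mx_of s) 0 dB.
  by rewrite mulr_ge0 ?mx_of_ge0.
have : 0 <= (kX B v)%:~R * (kY B v)%:~R :> R by rewrite -intrM ler0z.
rewrite -cX_ratio // -cY_ratio //.
move: hX hY; set x := cX B (_ / _); set y := cY B (_ / _); set z := (v 1 0)%:~R.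
move=> hX hY hxy.
have z0 : 0 < z * z by rewrite -expr2 exprn_even_gt0 //= intr_eq0.
have xy0 : 0 <= x * y.
  by rewrite -(pmulr_lge0 _ z0); move: hxy; rewrite mulrACA.
have xy : 0 < x * y.
  rewrite lt_neqAle xy0 eq_sym mulf_eq0 negb_or andbT.
  by apply/andP; split; apply/eqP => e; move: hX hY; rewrite e mul0r ltxx.
have := mulr_gt0 hX hY; rewrite mulrACA pmulr_rgt0 //.
Qed.

(** By [trapped_limit], crossing the root edge backwards would give the
    coordinates 1 and [- xi] the same sign, and a wrong turn at the [n]-th
    vertex would do so with the coordinates after that turn. *)
Lemma gamma_unique P xi : irr xi -> 0 < xi -> tree_path P ->
  P 0%N = initial_vertex -> leads_to P xi -> P = gamma xi.
Proof.
move=> ix x0 tP P0 lead.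
have trap m B dB sB eB := @trapped_limit P m B xi tP dB sB eB lead ix.
suff H m : P m = gamma xi m /\ P m.+1 = gamma xi m.+1.
  by apply/funext => m; have [] := H m.
have step n : P n = gamma xi n -> (P n.+1 <> start_vertex (euclid xi n)) ->
    P n.+1 = gamma xi n.+1.
  move=> Pn ne; have [adj _] := tP n; rewrite Pn in adj.
  have [//|[t Pn1]] := neighbour_cases (euclid_det xi n) adj.
  rewrite Pn1 /gamma /=; suff <- : t = greedy (euclid xi n) xi by [].
  have := trap n (euclid xi n * turnmx t).
  rewrite det_turn euclid_det start_turn Pn Pn1 => /(_ erefl erefl erefl).
  rewrite /greedy cX_turn cY_turn; have /andP[] := euclid_inside n ix x0.
  case: t {Pn1} => X0 Y0; first by rewrite pmulr_rgt0 // subr_gt0 => ->.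
  by rewrite pmulr_lgt0 // subr_gt0 => /ltW; rewrite leNgt => /negbTE ->.
elim: m => [|n [IH1 IH2]].
  split=> //; apply: step => // e.
  (* Leaving backwards means crossing the reversed root edge. *)
  have := trap 0%N (rev_edge 1%:M).
  rewrite rev_det det1 start_rev end_rev P0 e => /(_ erefl erefl erefl).
  by rewrite cX_rev cY_rev /cX /cY !mxE /=; nra.
split=> //; apply: step => // e.
by have [_] := tP n; rewrite IH1 e gamma_start.
Qed.

End Unique.

(** * Complete quotients and the lengths of blocks *)

Section Quotients.
Variable R : realType.
Implicit Types (A B C K : 'M[int]_2) (t d : bool) (xi eta eps x : R).
Implicit Types (P : nat -> set (set vec)) (c : nat -> nat) (xs : nat -> R).

(** The usual bound [1 < xs i.+1] would exclude zero partial quotients. *)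
Definition complete_quotients c xi xs :=
  [/\ xs 0%N = xi, forall i, 0 < xs i & forall i, xs i = (c i)%:R + (xs i.+1)^-1].

(** [x] is the complete quotient of [xi] at [A], if the next block consists of
    turns of type [d]: the coordinate that this block diminishes, divided by
    the other one. *)
Definition quotient_at d A xi x : Prop :=
  if d then cY A xi = x * cX A xi else cX A xi = x * cY A xi.

Lemma coords_turns A t n xi :
  cX (A * turnmx t ^+ n) xi =
    (if t then cX A xi else cX A xi - n%:R * cY A xi) /\
  cY (A * turnmx t ^+ n) xi =
    (if t then cY A xi - n%:R * cX A xi else cY A xi).
Proof.
elim: n => [|n [IHX IHY]].
  by rewrite expr0 mulr1 !mul0r !subr0 !if_same.
rewrite exprSr mulrA cX_turn cY_turn IHX IHY -natr1.
by case: t {IHX IHY}; split; ring.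
Qed.

Lemma mx_of_nseq n t : mx_of (nseq n t) = turnmx t ^+ n.
Proof.
elim: n => [|n IH]; first by rewrite /mx_of big_nil.
by rewrite exprS -IH /mx_of /= big_cons.
Qed.

Lemma mkseqSr (T : Type) (f : nat -> T) n :
  mkseq f n.+1 = rcons (mkseq f n) (f n).
Proof. by rewrite /mkseq -addn1 iotaD map_cat /= add0n cats1. Qed.

Lemma mkseqSl (T : Type) (f : nat -> T) n :
  mkseq f n.+1 = f 0%N :: mkseq (fun i => f i.+1) n.
Proof. by rewrite /mkseq /= (iotaDl 1) -map_comp. Qed.

Lemma cf_word_rcons s n :
  cf_word (rcons s n) = cf_word s ++ nseq n (odd (size s)).
Proof.
rewrite /cf_word size_rcons -addn1 iotaD map_cat flatten_cat /= add0n cats0.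
rewrite nth_rcons ltnn eqxx; congr (flatten _ ++ _).
apply/eq_in_map => i; rewrite mem_iota add0n => /andP[_ lti].
by rewrite nth_rcons lti.
Qed.

Definition followed xi (s : seq bool) := forall n, inside (mx_of (take n s)) xi.

Lemma followed_euclid xi s : followed xi s ->
  forall n, (n <= size s)%N -> mx_of (take n s) = euclid xi n.
Proof.
move=> fol; elim=> [|n IH] len; first by rewrite take0 /mx_of big_nil.
have -> : take n.+1 s = rcons (take n s) (nth false s n) by rewrite -take_nth.
rewrite mx_of_rcons IH 1?ltnW //=; congr (_ * turnmx _).
apply/esym/(@inside_turn_greedy _ _ _ xi).
by rewrite -IH 1?ltnW // -mx_of_rcons -take_nth.
Qed.

Lemma followed_cat xi s1 s2 : followed xi (s1 ++ s2) -> followed xi s1.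
Proof.
move=> fol n; have := fol (minn n (size s1)).
rewrite takel_cat ?geq_minr //.
case: (leqP n (size s1)) => // h.
by rewrite !take_oversize // ltnW.
Qed.

Lemma cf_path_gamma xi s : followed xi (cf_word s) ->
  cf_path s = mkseq (gamma xi) (size (cf_word s)).+1.
Proof.
move=> fol; apply/eq_in_map => n; rewrite mem_iota add0n ltnS => /andP[_ len].
by rewrite /gamma -(followed_euclid fol len).
Qed.

Lemma quotient_turns d A xi x x' n : x = n%:R + x'^-1 -> x' != 0 ->
  quotient_at d A xi x <-> quotient_at (~~ d) (A * turnmx d ^+ n) xi x'.
Proof.
move=> -> x0; have [eX eY] := coords_turns A d n xi.
rewrite /quotient_at; case: d eX eY => -> ->; split.
- by move=> ->; field.
- by move=> e; rewrite mulrDl {2}e mulKf //; ring.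
- by move=> ->; field.
- by move=> e; rewrite mulrDl {2}e mulKf //; ring.
Qed.

(** Used also for the conjugates of complete quotients, which may be
    negative. *)
Lemma quotient_expansion c y ys j : ys 0%N = y ->
  (forall i, ys i = (c i)%:R + (ys i.+1)^-1) -> (forall i, ys i != 0) ->
  quotient_at (odd j) (mx_of (cf_word (mkseq c j))) y (ys j).
Proof.
move=> y0 yrec yne; elim: j => [|j IH].
  by rewrite /mx_of /= big_nil /quotient_at /= /cX /cY !mxE /= y0; ring.
rewrite mkseqSr cf_word_rcons size_mkseq mx_of_cat mx_of_nseq [odd _]/=.
have [h _] := quotient_turns (odd j) (mx_of (cf_word (mkseq c j))) y
  (yrec j) (yne j.+1).
exact: h.
Qed.

(** Within a block, the coordinate that is diminished stays positive until
    [c j] turns are made, as the complete quotient exceeds [c j]. *)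
Lemma quotients_followed c xi xs : complete_quotients c xi xs ->
  forall j, followed xi (cf_word (mkseq c j)).
Proof.
move=> [x0 xpos xrec]; elim=> [|j fol].
  move=> n; have -> : take n (cf_word (mkseq c 0)) = [::] by case: n.
  by rewrite /mx_of big_nil /inside /cX /cY !mxE /=; have := xpos 0%N; lra.
have xne i : xs i != 0 by rewrite gt_eqF.
have quot := quotient_expansion j x0 xrec xne.
set w := cf_word _ in fol quot; rewrite mkseqSr cf_word_rcons size_mkseq -/w.
move=> n; rewrite take_cat; case: ltnP => // len.
have [m lem ->] : exists2 m, (m <= c j)%N &
    take (n - size w) (nseq (c j) (odd j)) = nseq m (odd j).
  case: (leqP (n - size w) (c j)) => h.
    by exists (n - size w)%N => //; rewrite take_nseq.
  by exists (c j) => //; rewrite take_oversize // size_nseq ltnW.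
rewrite mx_of_cat mx_of_nseq /inside.
have [-> ->] := coords_turns (mx_of w) (odd j) m xi.
have := fol (size w); rewrite take_size /inside => /andP[X0 Y0].
have lemR : m%:R <= (c j)%:R :> R by rewrite ler_nat.
have hinv : 0 < (xs j.+1)^-1 by rewrite invr_gt0.
have := xrec j; move: quot; rewrite /quotient_at.
by case: (odd j) => hq hx; apply/andP; split=> //; rewrite hq -mulrBl mulr_gt0 //; lra.
Qed.

Lemma quotients_describe c xi xs :
  complete_quotients c xi xs -> describes c (gamma xi).
Proof.
move=> cq j pi; have fol := quotients_followed cq j.
by rewrite /pi (cf_path_gamma fol) size_mkseq.
Qed.

Lemma quotients_pos c xi xs : complete_quotients c xi xs -> 0 < xi.
Proof. by case=> <-. Qed.

Definition cf_at (s : seq nat) x : R := foldr (fun n y => n%:R + y^-1) x s.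

Lemma turnsE A t n : let B := A * turnmx t ^+ n in
  (B 0 0 = A 0 0 + (if t then n%:Z * A 0 1 else 0)) *
  (B 1 0 = A 1 0 + (if t then n%:Z * A 1 1 else 0)) *
  (B 0 1 = A 0 1 + (if t then 0 else n%:Z * A 0 0)) *
  (B 1 1 = A 1 1 + (if t then 0 else n%:Z * A 1 0)).
Proof.
elim: n => [|m IH] /=; first by rewrite expr0 mulr1; case: t; rewrite !mul0r !addr0.
rewrite exprSr mulrA !turnE !IH intS.
by case: t {IH}; do !split; ring.
Qed.

(** [[s, x]] is the ratio of the vector with coordinates [x] and 1, in an
    order that alternates with the length of [s]. *)
Lemma cf_atE s x : 0 < x -> cf_at s x =
  let A := mx_of (cf_word s) in
  if odd (size s)
  then ((A 0 0)%:~R + (A 0 1)%:~R * x) / ((A 1 0)%:~R + (A 1 1)%:~R * x)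
  else ((A 0 0)%:~R * x + (A 0 1)%:~R) / ((A 1 0)%:~R * x + (A 1 1)%:~R).
Proof.
elim/last_ind: s x => [|s n IH] x x0.
  by rewrite /mx_of big_nil !mxE /=; field.
have xV : 0 < x^-1 by rewrite invr_gt0.
rewrite /cf_at foldr_rcons -/(cf_at s _) IH; last first.
  by have : 0 <= n%:R :> R by []; lra.
rewrite /= cf_word_rcons mx_of_cat mx_of_nseq size_rcons /=.
set A := mx_of _; set d := odd _.
have key (p q p' q' : R) : p' = p * x -> q' = q * x -> p / q = p' / q'.
  by move=> -> ->; rewrite -mulf_div divff ?mulr1 // gt_eqF.
rewrite !turnsE.
have x1 : x != 0 by rewrite gt_eqF.
by case: d {IH}; rewrite !addr0; apply: key; rewrite intrD intrM -pmulrn; field.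
Qed.

(** The last entry is positive, which excludes the places where the finite
    expansion would take the inverse of zero. *)
Lemma cf_fin_region s n : (0 < n)%N ->
  exists2 v, end_vertex (mx_of (cf_word (rcons s n))) (lax v) &
    cf_fin R (rcons s n) = (v 0 0)%:~R / (v 1 0)%:~R.
Proof.
move=> n0; have nR : 0 < n%:R :> R by rewrite ltr0n.
have cfE : cf_fin R (rcons s n) = cf_at s n%:R.
  by rewrite /cf_fin /cf_at foldr_rcons invr0 addr0.
rewrite cfE cf_atE // cf_word_rcons mx_of_cat mx_of_nseq /=.
set A := mx_of _; set d := odd _.
exists (if d then col 0 (A * turnmx d ^+ n) else col 1 (A * turnmx d ^+ n)).
  by case: d; left; [left|right].
case: d; rewrite !vecE !turnsE !intrD !intrM -pmulrn.
  by rewrite ![_ * n%:R]mulrC.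
by rewrite ![_ * n%:R]mulrC [X in X / _]addrC [X in _ / X]addrC.
Qed.

Lemma size_cf_word c m n : (forall i, (m <= i)%N -> (0 < c i)%N) ->
  (n <= m + size (cf_word (mkseq c n)))%N.
Proof.
move=> cpos; elim: n => // n IH.
rewrite mkseqSr cf_word_rcons size_cat size_nseq.
by case: (leqP m n) => [/cpos|]; lia.
Qed.

(** The convergents are the ratios of regions along [gamma xi]. *)
Lemma quotients_value c xi xs m : irr xi -> complete_quotients c xi xs ->
  (forall i, (m <= i)%N -> (0 < c i)%N) -> cf_value c xi.
Proof.
move=> ix cq cpos; have x0 := quotients_pos cq.
apply/cvgrPdist_lt => eps e0.
have [N _ near_N] := gamma_leads_to ix x0 e0.
exists (m + N).+1 => // -[//|n] lt_n.
have {}lt_n : (m + N <= n)%N by [].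
have cn : (0 < c n)%N by apply: cpos; lia.
have fol := quotients_followed cq n.+1.
rewrite mkseqSr; have [v hv ->] := cf_fin_region (mkseq c n) cn.
rewrite -mkseqSr in hv; rewrite distrC.

have [] := near_N (size (cf_word (mkseq c n.+1))) _ v => //.
  by have := size_cf_word n.+1 cpos; rewrite /=; lia.
by move: hv; rewrite -{1}[cf_word _]take_size (followed_euclid fol).
Qed.

End Quotients.

(** * Existence of complete quotients *)

Section Expansions.
Variable R : realType.
Implicit Types (xi eta x : R) (c : nat -> nat) (xs : nat -> R).

Lemma irr_neq0 x : irr x -> x != 0.
Proof. by move=> ix; apply/eqP => e; have := ix 0 1; rewrite e mulr0 => /(_ erefl). Qed.

Lemma irr_sub x (n : nat) : irr x -> irr (x - n%:R).
Proof.
move=> ix p q; rewrite mulrBr => e; apply: (ix (p + q * n%:Z)).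
by rewrite intrD intrM e -pmulrn; ring.
Qed.

Lemma irr_inv x : irr x -> irr x^-1.
Proof.
move=> ix p q e; have x0 := irr_neq0 ix.
by have [] := @irr_eq0 _ x q p ix; rewrite ?e ?divfK.
Qed.

(** The only sequence that can satisfy the recursion of complete quotients;
    it makes sense for an expansion [c] that is not one of [xi]. *)
Fixpoint tails c xi n : R :=
  if n is m.+1 then (tails c xi m - (c m)%:R)^-1 else xi.

Lemma tails_rec c xi n : tails c xi n = (c n)%:R + (tails c xi n.+1)^-1.
Proof. by rewrite /= invrK addrC subrK. Qed.

Lemma tails_irr c xi n : irr xi -> irr (tails c xi n).
Proof. by move=> ix; elim: n => //= n IH; apply/irr_inv/irr_sub. Qed.

Lemma tailsP c xi : (forall n, 0 < tails c xi n) ->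
  complete_quotients c xi (tails c xi).
Proof. by move=> h; split=> // i; apply: tails_rec. Qed.

Lemma cf_fin_ge0 s : 0 <= cf_fin R s.
Proof. by elim: s => //= n s IH; rewrite addr_ge0 ?invr_ge0. Qed.

(** From the second one on, the convergents of the tail are at most [c 1 + 1],
    hence their inverses stay away from zero, and the limit can be
    inverted. *)
Lemma value_tail c xi : genuine c -> cf_value c xi ->
  0 < xi - (c 0%N)%:R /\ cf_value (fun i => c i.+1) (xi - (c 0%N)%:R)^-1.
Proof.
move=> gc cvx; set y := fun n => cf_fin R (mkseq (fun i => c i.+1) n).
have cvy : (fun n => (y n)^-1) @ \oo --> xi - (c 0%N)%:R.
  have e : (fun n => (y n)^-1) = (fun n => cf_fin R (mkseq c n.+1) - (c 0%N)%:R).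
    by apply/funext => n; rewrite mkseqSl /= addrC addKr.
  rewrite e; apply: cvgB; last exact: cvg_cst.
  by move: cvx; rewrite /cf_value -cvg_shiftS.
have ylow n : ((c 1%N)%:R + 1)^-1 <= (y n.+1)^-1.
  have c1 : 1 <= (c 1%N)%:R :> R by rewrite ler1n gc.
  rewrite /y mkseqSl /=.
  case: n => [|n]; first by rewrite /= invr0 addr0 lef_pV2 ?posrE; lra.
  rewrite mkseqSl /=.
  set z := cf_fin _ _; have z0 : 0 <= z^-1 by rewrite invr_ge0 cf_fin_ge0.
  have c2 : 1 <= (c 2%N)%:R :> R by rewrite ler1n gc.
  have : ((c 2%N)%:R + z^-1)^-1 <= 1 by rewrite invf_le1; lra.
  have : 0 <= ((c 2%N)%:R + z^-1)^-1 by rewrite invr_ge0; lra.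
  set w := (_ + z^-1)^-1 => w0 w1.
  by rewrite lef_pV2 ?posrE; lra.
have pos : 0 < xi - (c 0%N)%:R.
  have : ((c 1%N)%:R + 1)^-1 <= xi - (c 0%N)%:R.
    rewrite -(cvg_lim (@Rhausdorff R) cvy).
    apply: limr_ge; first by apply/cvg_ex; exists (xi - (c 0%N)%:R).
    by exists 1%N => // -[//|n] _; apply: ylow.
  by apply: lt_le_trans; rewrite invr_gt0; have := ler0n R (c 1%N); lra.
split=> //; rewrite /cf_value -/y.
have -> : y = (fun n => ((y n)^-1)^-1) by apply/funext => n; rewrite invrK.
by apply: cvgV; rewrite ?gt_eqF.
Qed.

Lemma value_tails c xi n : genuine c -> cf_value c xi ->
  cf_value (fun i => c (n + i)%N) (tails c xi n).
Proof.
move=> gc cvx; elim: n => [|n IH] /=; first exact: cvx.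
have [|_] := value_tail _ IH; first by move=> i; rewrite addnS; apply: gc.
by rewrite addn0; under eq_fun do rewrite addnS -addSn.
Qed.

Lemma value_quotients c xi : genuine c -> cf_value c xi ->
  complete_quotients c xi (tails c xi).
Proof.
move=> gc cvx.
have pos n : 0 < tails c xi n - (c n)%:R.
  have [|h _] := value_tail _ (@value_tails _ _ n gc cvx).
    by move=> i; rewrite addnS; apply: gc.
  by rewrite addn0 in h.
apply: tailsP => -[|n] /=; last by rewrite invr_gt0.
by have := pos 0%N; have := ler0n R (c 0%N); rewrite /=; lra.
Qed.

Lemma genuine_expansion xi : irr xi -> 0 < xi ->
  exists2 c, genuine c & complete_quotients c xi (tails c xi).
Proof.
move=> ix x0.
pose ys := fix ys n := if n is m.+1 then (ys m - (Num.truncn (ys m))%:R)^-1 else xi.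
have ysi n : irr (ys n) by elim: n => //= n IH; apply/irr_inv/irr_sub.
have pos n : 0 < ys n /\ 1 < ys n.+1.
  have step m : 0 < ys m -> 1 < ys m.+1.
    move=> y0; have /andP[h1 h2] := truncn_itv (ltW y0).
    have ne := irr_neq0 (@irr_sub _ (Num.truncn (ys m)) (ysi m)).
    rewrite -natr1 in h2.
    have d0 : 0 < ys m - (Num.truncn (ys m))%:R by rewrite lt_neqAle eq_sym ne subr_ge0.
    by rewrite /= invf_gt1 //; lra.
  elim: n => [|n [IH1 IH2]]; first by split; last exact: step.
  have ys1 : 0 < ys n.+1 by lra.
  by split; last exact: step.
pose c n := Num.truncn (ys n).
have yE n : ys n = tails c xi n by elim: n => // n IH; rewrite /= -IH.
exists c.
  move=> i; have [_ h] := pos i; rewrite /c.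
  by rewrite truncn_gt0; exact: ltW.
by apply: tailsP => n; rewrite -yE; have [] := pos n.
Qed.

End Expansions.

(** * From the initial vertex to the river *)

Section Split.
Variable R : realType.
Implicit Types (A B C K : 'M[int]_2) (t : bool) (xi eta x : R).

(** Neither the cone of [A] nor its opposite contains (x, 1). *)
Definition opposite A x := cX A x * cY A x < 0.

Lemma opposite_turn A t x : opposite A x -> opposite (A * turnmx t) x.
Proof.
rewrite /opposite cX_turn cY_turn; case: t => h.
  by have := sqr_ge0 (cX A x); lra.
by have := sqr_ge0 (cY A x); lra.
Qed.

Lemma opposite_words A s x : opposite A x -> opposite (A * mx_of s) x.
Proof.
move=> oA; elim/last_ind: s => [|s t IH]; first by rewrite /mx_of big_nil mulr1.
by rewrite mx_of_rcons mulrA; apply: opposite_turn.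
Qed.

(** The paths of [xi] and [eta] part at their [N]-th vertex. *)
Definition split_at xi eta N :=
  (forall n, (n <= N)%N -> euclid xi n = euclid eta n) /\
  greedy (euclid xi N) xi != greedy (euclid eta N) eta.

Lemma split_atC xi eta N : split_at xi eta N -> split_at eta xi N.
Proof. by case=> e ne; split=> [n /e //|]; rewrite eq_sym. Qed.

Lemma split_words xi eta w t :
  followed xi (rcons w t) -> followed eta (rcons w (~~ t)) ->
  split_at xi eta (size w).
Proof.
move=> fx fe.
have pre (y : R) u n : followed y (rcons w u) -> (n <= size w)%N ->
    euclid y n = mx_of (take n w).
  move=> fol len; have len' : (n <= size (rcons w u))%N by rewrite size_rcons; lia.
  by rewrite -(followed_euclid fol len') -cats1 takel_cat.
have turn (y : R) u : followed y (rcons w u) -> greedy (euclid y (size w)) y = u.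
  move=> fol; apply: (@inside_turn_greedy _ _ _ y).
  rewrite (pre _ _ _ fol (leqnn _)) take_size -mx_of_rcons.
  by have := fol (size (rcons w u)); rewrite take_size.
split=> [n len|]; first by rewrite (pre _ _ _ fx len) (pre _ _ _ fe len).
by rewrite (turn _ _ fx) (turn _ _ fe); case: (t).
Qed.

Lemma leads_to_unique P xi eta : (forall n, exists v, P n (lax v)) ->
  leads_to P xi -> leads_to P eta -> xi = eta.
Proof.
move=> Pv lx le; apply/eqP; rewrite -subr_eq0 -normr_eq0; apply: contraT => ne.
have d0 : 0 < `|xi - eta| / 2 by rewrite divr_gt0 // lt_neqAle eq_sym ne normr_ge0.
have [n _ hn] := lx _ d0; have [m _ hm] := le _ d0.
have [v hv] := Pv (maxn n m).
have [|_ h1] := hn (maxn n m) _ v hv; first by rewrite /= leq_maxl.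
have [|_ h2] := hm (maxn n m) _ v hv; first by rewrite /= leq_maxr.
move: h1 h2; set z := _ / _ => h1 h2.
have := ler_distD z xi eta; rewrite [`|xi - z|]distrC.
lra.
Qed.

(** Otherwise the two paths coincide and lead to both numbers. *)
Lemma split_exists xi eta : irr xi -> irr eta -> 0 < xi -> 0 < eta ->
  xi != eta -> exists N, split_at xi eta N.
Proof.
move=> ix ie x0 e0 ne.
have [[n hn]|nex] := pselect (exists n, greedy (euclid xi n) xi != greedy (euclid eta n) eta).
  have ex : exists n, greedy (euclid xi n) xi != greedy (euclid eta n) eta by exists n.
  case: (ex_minnP ex) => N hN minN; exists N; split=> //.
  elim=> [//|m IH] ltm /=; have same := IH (ltnW ltm).
  rewrite same; congr (_ * turnmx _); apply/eqP.
  apply: contraTT ltm => hm; rewrite -leqNgt; apply: minN.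
  by rewrite same.
have same n : euclid xi n = euclid eta n.
  elim: n => //= n IH; rewrite IH; congr (_ * turnmx _).
  by apply/eqP; apply: contrapT => /negP h; apply: nex; exists n; rewrite IH.
case/negP: ne; apply/eqP; apply: (@leads_to_unique (gamma xi)).
- by move=> n; exists (col 0 (euclid xi n)); left; left.
- exact: gamma_leads_to.
- have -> : gamma xi = gamma eta by apply/funext => n; rewrite /gamma same.
  exact: gamma_leads_to.
Qed.

Section WithForm.
Variables (Q : vec -> int) (k xi eta : R).
Hypothesis k_gt0 : 0 < k.
Hypothesis QE : forall v, (Q v)%:~R =
  k * (((v 0 0)%:~R - (v 1 0)%:~R * xi) * ((v 0 0)%:~R - (v 1 0)%:~R * eta)).

Lemma QN v : Q (- v) = Q v.
Proof.
apply/eqP; rewrite -(eqr_int R) !QE !vecE !intrN; apply/eqP; ring.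
Qed.

Lemma Q_lax u v : lax u = lax v -> Q u = Q v.
Proof. by move=> /lax_inj[] ->; rewrite ?QN. Qed.

Lemma Q_col0 A : (Q (col 0 A))%:~R = k * (cY A xi * cY A eta).
Proof. by rewrite QE !vecE. Qed.

Lemma Q_col1 A : (Q (col 1 A))%:~R = k * (cX A xi * cX A eta).
Proof. by rewrite QE !vecE /cX; ring. Qed.

Lemma Q_mid A : (Q (col 0 A + col 1 A))%:~R =
  k * ((cY A xi - cX A xi) * (cY A eta - cX A eta)).
Proof. by rewrite QE !vecE /cX /cY !intrD; ring. Qed.

Lemma river_edge A : \det A = 1 -> Q (col 0 A) * Q (col 1 A) < 0 ->
  river Q (edge_of A).
Proof.
move=> dA; case: (ltrgtP 0 (Q (col 0 A))) => [h0|h0|<-]; last by rewrite mul0r ltxx.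
- by rewrite pmulr_rlt0 // => h1; exists A; split=> //; apply: det1_unit.
- rewrite nmulr_rlt0 // => h1; exists (rev_edge A); split.
  + by apply: det1_unit; rewrite rev_det.
  + by rewrite edge_rev.
  + by rewrite col_rev.
  + by rewrite col_rev QN.
Qed.

Lemma river_crossing A : \det A = 1 -> inside A xi -> opposite A eta ->
  river Q (edge_of A).
Proof.
move=> dA /andP[X0 Y0] op; apply: river_edge => //.
rewrite -(ltr_int R) intrM Q_col0 Q_col1 mulrACA pmulr_rlt0 ?mulr_gt0 //.
rewrite mulrACA pmulr_rlt0 ?mulr_gt0 //.
by rewrite mulrC.
Qed.

Lemma not_on_river A :
  0 < Q (col 0 A) -> 0 < Q (col 1 A) -> 0 < Q (col 0 A + col 1 A) ->
  ~ on_river Q (end_vertex A).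
Proof.
move=> h0 h1 h2 [e [B [_ -> _ neg]] sub].
have /sub [[]|] : edge_of B (lax (col 1 B)) by right.
- by move=> /Q_lax eq; move: neg; rewrite eq; lia.
- by move=> /Q_lax eq; move: neg; rewrite eq; lia.
- by move=> /Q_lax eq; move: neg; rewrite eq; lia.
Qed.

Hypotheses (ix : irr xi) (ie : irr eta) (x0 : 0 < xi) (e0 : 0 < eta).
Variable N : nat.
Hypothesis split : split_at xi eta N.

(** The turn at which the paths part takes [eta] out of the cone, and no later
    turn brings it back. *)
Lemma split_opposite n : (N < n)%N -> opposite (euclid xi n) eta.
Proof.
have [same ne] := split; elim: n => // n IH; rewrite ltnS leq_eqVlt.
case/orP => [/eqP <-|/IH h]; last exact: opposite_turn.
have {}ne : greedy (euclid xi N) xi != (cX (euclid xi N) eta < cY (euclid xi N) eta).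
  by move: ne; rewrite -same.
have := euclid_inside N ie e0; rewrite -same // => /andP[X0 Y0].
have [_ _ XY] := irr_coords ie (euclid_det xi N).
rewrite /opposite /= cX_turn cY_turn; move: ne.
case: (greedy _ xi); case: (ltrgtP (cX _ eta) (cY _ eta)) XY => //= h _ _.
  by rewrite pmulr_rlt0 // subr_lt0.
by rewrite pmulr_llt0 // subr_lt0.
Qed.

(** The two roots lie on the same side of the third region as long as the
    next turn is the same for both. *)
Lemma gamma_off_river n : (n < N)%N -> ~ on_river Q (gamma xi n).
Proof.
move=> ltn; have [same _] := split.
have := euclid_inside n ix x0 => /andP[X0 Y0].
have := euclid_inside n ie e0; rewrite -same ?(ltnW ltn) // => /andP[X0' Y0'].
have := euclid_inside n.+1 ix x0; rewrite /= => in1.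
have := euclid_inside n.+1 ie e0; rewrite -same //= => in2.
apply: not_on_river; rewrite -(ltr_int R) ?Q_col0 ?Q_col1 ?Q_mid.
- by rewrite !mulr_gt0.
- by rewrite !mulr_gt0.
- rewrite mulr_gt0 //; move: in1 in2; rewrite /inside !cX_turn !cY_turn.
  case: (greedy _ _) => /andP[h1 h2] /andP[h3 h4]; first by rewrite mulr_gt0.
  by rewrite nmulr_rgt0 -oppr_gt0 opprB.
Qed.

Lemma gamma_reaches_river : on_river Q (gamma xi N).
Proof.
exists (edge_of (euclid xi N.+1)).
  by apply: river_crossing; [apply: euclid_det|apply: euclid_inside|apply: split_opposite].
by rewrite -gamma_meet; apply: subIsetl.
Qed.

Lemma gamma_river_path : river_path Q xi (gamma xi).
Proof.
split; [exact: gamma_tree_path|by []|exact: gamma_leads_to|].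
exists N; split=> [n|n len]; first exact: gamma_off_river.
rewrite gamma_meet; apply: river_crossing; first exact: euclid_det.
  exact: euclid_inside.
exact: split_opposite.
Qed.

Lemma gamma_part_to_river :
  part_to_river Q (gamma xi) (mkseq (gamma xi) N.+1).
Proof.
by exists N; split=> //; [exact: gamma_off_river|exact: gamma_reaches_river].
Qed.

End WithForm.
End Split.

(** * The river as a chain of oriented edges *)

Section River.
Variable R : realType.
Variables (xi eta : R).
Hypotheses (ix : irr xi) (x0 : 0 < xi).
Implicit Types (A B C K : 'M[int]_2) (t : bool).

(** The edges of the river, oriented towards [xi]. *)
Definition downstream A := [/\ \det A = 1, inside A xi & opposite A eta].

(** Let X, Y be the coordinates of [eta] in a predecessor followed by a left
    turn.  In a predecessor followed by a right turn they would be X - Y and X;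
    opposite signs in both would give X Y < 0 and (X - Y) X < 0, hence
    X^2 < 0. *)
Lemma downstream_pred B B' t t' : downstream B -> downstream B' ->
  B * turnmx t = B' * turnmx t' -> B = B'.
Proof.
move=> oB oB'; have diff C C' : downstream C -> downstream C' ->
    C * turnmx false = C' * turnmx true -> False.
  move=> [_ _ oC] [_ _ oC'] e.
  have eX : cX C eta - cY C eta = cX C' eta.
    by rewrite -(cX_turn C false) e cX_turn.
  have eY : cY C eta = cY C' eta - cX C' eta.
    by rewrite -(cY_turn C false) e cY_turn.
  move: oC oC'; rewrite /opposite -eX (_ : cY C' eta = cX C eta).
    by have := sqr_ge0 (cX C eta); lra.
  by rewrite -[LHS](subrK (cX C' eta)) -eY -eX; ring.
case: t t' => -[] e.
- by apply: (mulIr (turn_unit true)).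
- by case: (diff _ _ oB' oB).
- by case: (diff _ _ oB oB').
- by apply: (mulIr (turn_unit false)).
Qed.

(** The regions along the path of [xi] end up in the open cone of [C], which
    contains (xi, 1); the change of basis is then nonnegative. *)
Lemma downstream_absorbs C : downstream C ->
  exists N, forall n, (N <= n)%N -> exists s, euclid xi n = C * mx_of s.
Proof.
move=> [dC /andP[X0 Y0] _].
have [eps eps0 stable] := coords_stable (lt0r_neq0 X0) (lt0r_neq0 Y0).
have [N _ near_N] := gamma_leads_to ix x0 eps0.
exists N => n len; set E := euclid xi n.
have CU : C \is a GRing.unit by apply: det1_unit.
pose K : 'M[int]_2 := C^-1 * E.
have CK : E = C * K by rewrite /K mulVKr.
have pos j : 0 <= kX C (col j E) /\ 0 <= kY C (col j E).
  have hj : gamma xi n (lax (col j E)).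
    by move: j; apply: ord2P; left; [left|right].
  have [v0 /stable[]] := near_N n len _ hj.
  have v1 : 0 < (col j E 1 0)%:~R :> R.
    by rewrite ltr0z lt_neqAle eq_sym v0 vecE euclid_ge0.
  rewrite !pmulr_lgt0 // => hX hY.
  rewrite -!(ler0z R) -cX_ratio // -cY_ratio //.
  by split; apply: mulr_ge0; apply: ltW.
have dK : \det K = 1.
  by have := euclid_det xi n; rewrite -/E CK -mulmxE det_mulmx dC mul1r.
have K0 i j : 0 <= K i j.
  have := pos j; rewrite CK; have [-> ->] := coords_mul K j dC.
  by move=> []; move: i; apply: ord2P.
by have [s Ks] := nonneg_factor dK K0; exists s; rewrite -Ks.
Qed.

Variables (M : int -> 'M[int]_2) (t : int -> bool) (S : nat).
Hypothesis downM : forall n, downstream (M n).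
Hypothesis stepM : forall n, M (n + 1) = M n * turnmx (t n).
Hypothesis M_forward : forall n : nat, M n%:Z = euclid xi (S + n).

(** [C] and the path [M] both lead to one late edge of the path of [xi]; going
    back from there, predecessors are unique. *)
Lemma downstream_surj C : downstream C -> exists n, C = M n.
Proof.
move=> oC; have [N absorb] := downstream_absorbs oC.
have [|s] := absorb (S + N)%N; first by rewrite leq_addl.
rewrite -M_forward; move: (N%:Z) => n.
elim/last_ind: s n => [|s u IH] n; first by rewrite /mx_of big_nil mulr1; exists n.
have stepn : M n = M (n - 1) * turnmx (t (n - 1)) by rewrite -stepM subrK.
rewrite mx_of_rcons mulrA => e; apply: (IH (n - 1)).
apply: (@downstream_pred _ _ (t (n - 1)) u) => //; last by rewrite -stepn.
have [dC _ opC] := oC; have [_ inM _] := downM n; split.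
- by rewrite det_words.
- by move: inM; rewrite e => /inside_turn.
- exact: opposite_words.
Qed.

Lemma upstream_chain (B : nat -> 'M[int]_2) n :
  (forall m, exists u, B m.+1 * turnmx u = B m) ->
  (forall m, opposite (B m) eta) -> B 0%N = M n ->
  forall m, B m = M (n - m%:Z).
Proof.
move=> Bstep Bop B0; elim=> [|m IH]; first by rewrite subr0.
have [u e] := Bstep m; set n' := n - m.+1%:Z.
have n'E : n - m%:Z = n' + 1 by rewrite /n' intS; ring.
rewrite n'E stepM in IH; apply: (@downstream_pred _ _ u (t n')) => //.
  have [dM inM _] := downM (n' + 1); rewrite stepM -IH -e in dM inM.
  split=> //; first by rewrite -(det_turn _ u).
  exact: inside_turn inM.
by rewrite e.
Qed.

Lemma detN A : \det (- A) = \det A.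
Proof. by rewrite !det22 !mxE; ring. Qed.

Lemma cXN A y : cX (- A) y = - cX A y :> R.
Proof. by rewrite /cX !mxE !intrN; ring. Qed.

Lemma cYN A y : cY (- A) y = - cY A y :> R.
Proof. by rewrite /cY !mxE !intrN; ring. Qed.

Lemma oppositeN A (y : R) : opposite A y -> opposite (- A) y.
Proof. by rewrite /opposite cXN cYN mulrNN. Qed.

Lemma opposite_rev A (y : R) : opposite (rev_edge A) y = (0 < cX A y * cY A y).
Proof. by rewrite /opposite cX_rev cY_rev mulrN oppr_lt0 mulrC. Qed.

Lemma inside_sign A (y : R) : 0 < cX A y * cY A y -> inside A y \/ inside (- A) y.
Proof.
rewrite /inside cXN cYN !oppr_gt0; case: (ltrgtP (cX A y) 0) => h.
- by rewrite nmulr_rgt0 // => ->; right.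
- by rewrite pmulr_rgt0 // => ->; left.
- by rewrite h mul0r ltxx.
Qed.

Lemma downstream_sign A : \det A = 1 -> 0 < cX A xi * cY A xi ->
  opposite A eta -> downstream A \/ downstream (- A).
Proof.
move=> dA /inside_sign[] inA op; [left|right]; split=> //.
  by rewrite detN.
exact: oppositeN.
Qed.

(** The columns of an oriented edge are determined up to a common sign; one
    choice makes the coordinates of [xi] positive, the other negative. *)
Lemma rev_downstream A : \det A = 1 -> opposite A xi -> 0 < cX A eta * cY A eta ->
  downstream (rev_edge A) \/ downstream (- rev_edge A).
Proof.
move=> dA op XY; apply: downstream_sign; rewrite ?rev_det ?opposite_rev //.
by move: op; rewrite /opposite cX_rev cY_rev mulrN oppr_gt0 mulrC.
Qed.

Section Edges.
Variables (Q : vec -> int) (k : R).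
Hypothesis k_gt0 : 0 < k.
Hypothesis QE : forall v, (Q v)%:~R =
  k * (((v 0 0)%:~R - (v 1 0)%:~R * xi) * ((v 0 0)%:~R - (v 1 0)%:~R * eta)).

(** Let X, Y be the coordinates of [xi] in an edge and X', Y' those of [eta].
    The values at its two regions have opposite signs exactly when one of X Y
    and X' Y' is positive and the other negative.  If X Y is positive, the
    edge is [downstream] up to sign; otherwise its reversal is. *)
Lemma river_edges : river Q = [set edge_of (M n) | n in setT].
Proof.
apply/seteqP; split=> e; last first.
  by case=> n _ <-; have [dM inM op] := downM n; apply: (river_crossing k_gt0 QE).
case=> A [uA -> pos neg].
have [C [dC eC neg']] : exists C, [/\ \det C = 1, edge_of C = edge_of A &
    (Q (col 0 C))%:~R * (Q (col 1 C))%:~R < 0 :> R].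
  have negA : (Q (col 0 A))%:~R * (Q (col 1 A))%:~R < 0 :> R.
    by rewrite -intrM ltrz0 pmulr_rlt0.
  have [dA|dA] : \det A = 1 \/ \det A = - 1.
    by move: uA; rewrite unitmxE => /orP[] /eqP; [left|right].
    by exists A.
  exists (\matrix_(i, j) if j == 0 then A i 0 else - A i 1).
  set C := \matrix_(i, j) _.
  have [c0 c1] : col 0 C = col 0 A /\ col 1 C = - col 1 A.
    by split; apply: vecP; rewrite !vecE /C !mxE.
  split; first by move: dA; rewrite !det22 !mxE /=; lia.
    by rewrite /edge_of c0 c1 laxN.
  by rewrite c0 c1 (QN QE).
have [X0 Y0 _] := irr_coords ix dC.
suff [d|[d|[d|d]]] : downstream C \/ downstream (- C) \/
    downstream (rev_edge C) \/ downstream (- rev_edge C).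
- by have [n e'] := downstream_surj d; exists n; rewrite // -e'.
- by have [n e'] := downstream_surj d; exists n; rewrite // -e' edge_ofN.
- by have [n e'] := downstream_surj d; exists n; rewrite // -e' edge_rev.
- by have [n e'] := downstream_surj d; exists n; rewrite // -e' edge_ofN edge_rev.
have : 0 < cX C xi * cY C xi /\ opposite C eta \/
       opposite C xi /\ 0 < cX C eta * cY C eta.
  have k2 : 0 < k * k by apply: mulr_gt0.
  move: neg'; rewrite (Q_col0 QE) (Q_col1 QE) mulrACA (pmulr_rlt0 _ k2).
  rewrite mulrACA [cY C xi * _]mulrC [cY C eta * _]mulrC /opposite.
  case: (ltrgtP (cX C xi * cY C xi) 0) => [h|h|->]; last by rewrite mul0r ltxx.
    by rewrite nmulr_rlt0 // => h'; right.
  by rewrite pmulr_rlt0 // => h'; left.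
case=> -[h1 h2].
  by have [] := downstream_sign dC h1 h2; tauto.
by have [] := rev_downstream dC h1 h2; tauto.
Qed.

End Edges.

Hypotheses (ie : irr eta) (e0 : 0 < eta).

(** The path of [eta], once on the river, consists of reversed [downstream]
    edges; hence it is [M] traversed backwards. *)
Lemma upstream_leads_to N : split_at xi eta N ->
  leads_to (fun n => end_vertex (M (- n%:Z))) eta.
Proof.
move=> /split_atC split.
(* The first edge of the path of [eta] on the river is the one after step [N]. *)
pose B m := rev_edge (euclid eta (N.+1 + m)).
have opx m : opposite (euclid eta (N.+1 + m)) xi.
  by apply: (split_opposite ix x0 split); rewrite addSn ltnS leq_addr.
have ine m := euclid_inside (N.+1 + m) ie e0.
have stepB m : exists u, B m.+1 * turnmx u = B m.
  exists (~~ greedy (euclid eta (N.+1 + m)) eta).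
  by rewrite /B addnS /= rev_turn.
have opB m : opposite (B m) eta.
  by have /andP[X0 Y0] := ine m; rewrite opposite_rev mulr_gt0.
have [n0 hn] : exists n0 : int, forall m, end_vertex (B m) = end_vertex (M (n0 - m%:Z)).
  have XY0 m : 0 < cX (euclid eta (N.+1 + m)) eta * cY (euclid eta (N.+1 + m)) eta.
    by have /andP[X0 Y0] := ine m; apply: mulr_gt0.
  have [d|d] := rev_downstream (euclid_det eta (N.+1 + 0)) (opx 0%N) (XY0 0%N).
    have [n0 e] := downstream_surj d; exists n0 => m.
    by rewrite (upstream_chain stepB opB e).
  have [n0 e] := downstream_surj d; exists n0 => m.
  have h := @upstream_chain (fun m => - B m) n0 _ _ e.
  rewrite -end_vertexN h //.
    by move=> i; have [u <-] := stepB i; exists u; rewrite mulNr.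
  by move=> i; apply: oppositeN.
move=> eps eps0; have [n1 _ near_n] := gamma_leads_to ie e0 eps0.
exists (`|n0| + n1)%N => // n /= len v.
have [m mE] : exists m : nat, - n%:Z = n0 - m%:Z.
  by exists `|(n0 + n%:Z)%R|%N; lia.
rewrite mE -hn end_rev addSn -gamma_start; apply: near_n.
by rewrite /=; lia.
Qed.

End River.

(** * Recursion over the integers *)

Section Integers.

Lemma int_both_ways (P : int -> Prop) n0 : P n0 ->
  (forall n, P n <-> P (n + 1)) -> forall n, P n.
Proof.
move=> P0 step n; rewrite -(subrK n0 n); case: (n - n0) => m.
  elim: m => [|m IH]; first by rewrite add0r.
  have -> : m.+1%:Z + n0 = m%:Z + n0 + 1 by lia.
  by have [up _] := step (m%:Z + n0); apply: up.
elim: m => [|m IH].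
  have [_ down] := step (Negz 0 + n0); apply: down.
  by rewrite (_ : Negz 0 + n0 + 1 = n0) //; lia.
have [_ down] := step (Negz m.+1 + n0); apply: down.
by rewrite (_ : Negz m.+1 + n0 + 1 = Negz m + n0) //; lia.
Qed.

(** Below 0 the recursion is solved with the right inverses [g] of [f]. *)
Lemma int_recursion (T : Type) (f g : int -> T -> T) (x : T) :
  (forall n y, f n (g n y) = y) ->
  exists2 u : int -> T, u 0 = x & forall n, u (n + 1) = f n (u n).
Proof.
move=> fg.
pose up := fix up n := if n is m.+1 then f m%:Z (up m) else x.
pose down := fix down n := if n is m.+1 then g (Negz m) (down m) else x.
exists (fun n => if n is Negz m then down m.+1 else up `|n|%N) => //.
case=> m; first by rewrite (_ : Posz m + 1 = m.+1%:Z) //; lia.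
case: m => [|m]; first by rewrite (_ : Negz 0 + 1 = 0%N%:Z) //= fg.
by rewrite (_ : Negz m.+1 + 1 = Negz m) //= ?fg //; lia.
Qed.

Lemma odd_abszS (j : int) : odd `|(j + 1)%R|%N = ~~ odd `|j|%N.
Proof.
case: j => m; first by rewrite (_ : Posz m + 1 = m.+1%:Z) //; lia.
case: m => [|m] //; rewrite (_ : Negz m.+1 + 1 = Negz m); last by lia.
by rewrite /= !negbK.
Qed.

End Integers.

(** * The bi-infinite path with given blocks *)

Section Blocks.

(** As all blocks are nonempty, their ends are unbounded in both directions,
    and every integer lies in exactly one block. *)
Lemma blocks_exist (cb : int -> nat) (d : bool) : (forall j, 0 < cb j)%N ->
  exists s t, [/\ s 1 = 0, (forall j, s (j + 1) = s j + (cb j)%:Z),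
    (forall j i, s j <= i < s (j + 1) -> t i = d (+) odd `|j|%N) &
    forall i, exists j, s j <= i < s (j + 1)].
Proof.
move=> cb_gt0.
have [s' s'0 s'S] := @int_recursion int (fun n x => x + (cb (n + 1))%:Z)
  (fun n x => x - (cb (n + 1))%:Z) 0 (fun n y => subrK _ _).
pose s j := s' (j - 1).
have sS j : s (j + 1) = s j + (cb j)%:Z.
  by have := s'S (j - 1); rewrite /s !subrK addrK.
have s1 : s 1 = 0 by rewrite /s subrr.
have mono j (n : nat) : s j <= s (j + n%:Z).
  elim: n => [|n IH]; first by rewrite addr0.
  have -> : j + n.+1%:Z = j + n%:Z + 1 by lia.
  by rewrite sS; lia.
have lookup i : exists j, s j <= i < s (j + 1).
  move: i; apply: (int_both_ways (n0 := 0)).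
    by exists 1; rewrite sS s1 lexx add0r ltz_nat cb_gt0.
  move=> i; split=> -[j hj].
    case: (ltrP (i + 1) (s (j + 1))) => h; first by exists j; lia.
    by exists (j + 1); rewrite (sS (j + 1)); have := cb_gt0 (j + 1); lia.
  case: (lerP (s j) i) => h; first by exists j; lia.
  exists (j - 1); have := sS (j - 1); rewrite subrK => e.
  by have := cb_gt0 (j - 1); lia.
have [J hJ] := choice lookup.
exists s, (fun i => d (+) odd `|J i|%N); split=> // j i hj.
suff -> : J i = j by [].
have hi := hJ i; apply/eqP; rewrite eq_le; apply/andP; split.
  rewrite leNgt; apply/negP => h; have := mono (j + 1) `|(J i - (j + 1))%R|%N.
  have -> : j + 1 + `|(J i - (j + 1))%R|%N%:Z = J i by lia.
  by lia.
rewrite leNgt; apply/negP => h; have := mono (J i + 1) `|(j - (J i + 1))%R|%N.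
have -> : J i + 1 + `|(j - (J i + 1))%R|%N%:Z = j by lia.
by lia.
Qed.

Variable R : realType.
Variables (xi eta : R).
Hypotheses (ix : irr xi) (ie : irr eta) (x0 : 0 < xi).

(** After [m] turns of type [d] the ratio of the coordinates is [x - m], so
    the sign of their product is that of [x - m]. *)
Lemma quotient_product d A (y x : R) (m : nat) : irr y -> \det A = 1 ->
  quotient_at d A y x -> exists2 z : R, 0 < z &
  cX (A * turnmx d ^+ m) y * cY (A * turnmx d ^+ m) y = (x - m%:R) * z.
Proof.
move=> iy dA; have [X0 Y0 _] := irr_coords iy dA.
have [-> ->] := coords_turns A d m y; rewrite /quotient_at.
case: d => ->.
  exists (cX A y ^+ 2); last by ring.
  by rewrite exprn_even_gt0.
exists (cY A y ^+ 2); last by ring.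
by rewrite exprn_even_gt0.
Qed.

Variables (cb : int -> nat) (theta thetabar : int -> R).
Hypothesis cb_gt0 : forall j, (0 < cb j)%N.
Hypothesis thetaS : forall j, theta j = (cb j)%:R + (theta (j + 1))^-1.
Hypothesis thetabarS : forall j, thetabar j = (cb j)%:R + (thetabar (j + 1))^-1.
Hypothesis theta_gt0 : forall j, 0 < theta j.
Hypothesis thetabar_lt0 : forall j, thetabar j < 0.
Variables (S : nat) (d : bool).
Hypothesis quot : quotient_at d (euclid xi S) xi (theta 1).
Hypothesis quotbar : quotient_at d (euclid xi S) eta (thetabar 1).

(** At both ends of each block the ratios of the coordinates of [xi] and [eta]
    are [theta j] and [thetabar j].  Inside a block, at most [cb j] is
    subtracted from them: [theta j] remains positive, as
    [theta j > cb j], and [thetabar j] remains negative. *)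
Lemma bi_infinite_path : exists (M : int -> 'M[int]_2) (t : int -> bool),
  [/\ forall n, downstream xi eta (M n),
      forall n, M (n + 1) = M n * turnmx (t n),
      forall n : nat, M n%:Z = euclid xi (S + n) &
      turn_blocks t cb].
Proof.
have [s [t [s1 sS tE lookup]]] := blocks_exist (~~ d) cb_gt0.
have [M M0 MS] := @int_recursion 'M[int]_2 (fun n A => A * turnmx (t n))
  (fun n A => A * (turnmx (t n))^-1) (euclid xi S)
  (fun n A => mulrVK (turn_unit (t n)) A).
exists M, t.
have dM : forall n, \det (M n) = 1.
  apply: (int_both_ways (n0 := 0)); first by rewrite M0 euclid_det.
  by move=> n; rewrite MS det_turn.
pose ty j := ~~ d (+) odd `|j|%N.
have block j (m : nat) : (m <= cb j)%N ->
    M (s j + m%:Z) = M (s j) * turnmx (ty j) ^+ m.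
  elim: m => [|m IH] lem; first by rewrite addr0 expr0 mulr1.
  have -> : s j + m.+1%:Z = s j + m%:Z + 1 by lia.
  rewrite MS IH 1?ltnW // (tE j); last by rewrite sS; lia.
  by rewrite exprSr mulrA.
have Q : forall j, quotient_at (ty j) (M (s j)) xi (theta j) /\
                   quotient_at (ty j) (M (s j)) eta (thetabar j).
  apply: (int_both_ways (n0 := 1)); first by rewrite s1 M0 /ty addbT negbK.
  move=> j; have -> : ty (j + 1) = ~~ ty j by rewrite /ty odd_abszS addbN.
  rewrite sS block //.
  have ne : theta (j + 1) != 0 by rewrite gt_eqF.
  have neb : thetabar (j + 1) != 0 by rewrite lt_eqF.
  have [h1 h2] := quotient_turns (ty j) (M (s j)) xi (thetaS j) ne.
  have [h3 h4] := quotient_turns (ty j) (M (s j)) eta (thetabarS j) neb.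
  by split=> -[q1 q2]; split; auto.
have sign n : 0 < cX (M n) xi * cY (M n) xi /\ opposite (M n) eta.
  have [j hj] := lookup n; rewrite sS in hj.
  have [m mlt nE] : exists2 m, (m < cb j)%N & n = s j + m%:Z.
    by exists `|(n - s j)%R|%N; lia.
  have [q qb] := Q j; rewrite nE block 1?ltnW // /opposite.
  have [z z0 ->] := quotient_product m ix (dM (s j)) q.
  have [z' z'0 ->] := quotient_product m ie (dM (s j)) qb.
  rewrite pmulr_lgt0 // pmulr_llt0 //; split.
    rewrite subr_gt0 thetaS; have : m%:R <= (cb j)%:R :> R by rewrite ler_nat ltnW.
    by have : 0 < (theta (j + 1))^-1 by [rewrite invr_gt0]; lra.
  by rewrite subr_lt0 (lt_le_trans (thetabar_lt0 j)).
have inM : forall n, inside (M n) xi.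
  apply: (int_both_ways (n0 := 0)); first by rewrite M0; apply: euclid_inside.
  move=> n; rewrite MS; split; last exact: inside_turn.
  have [+ _] := sign (n + 1); rewrite MS /inside cX_turn cY_turn.
  case: (t n) => + /andP[X0 Y0]; first by rewrite pmulr_rgt0 // => ->; rewrite X0.
  by rewrite pmulr_lgt0 // => ->.
split=> //.
- by move=> n; have [_ op] := sign n; split.
- elim=> [|n IH]; first by rewrite addn0.
  have -> : n.+1%:Z = n%:Z + 1 by lia.
  have := inM (n%:Z + 1); rewrite MS IH => /inside_turn_greedy <-.
  by rewrite addnS.
- by exists s, (~~ d).
Qed.

End Blocks.

(** * Conjugate complete quotients *)

Section Conjugates.

Lemma tails_periodic (R : realType) (c : nat -> nat) (xi : R) K l :
  genuine c -> cf_value c xi ->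
  (forall i, (K <= i)%N -> c (i + l)%N = c i) ->
  forall n, (K <= n)%N -> tails c xi (n + l) = tails c xi n.
Proof.
move=> gc cvx periodic n len; have v1 := value_tails (n := n) gc cvx.
have v2 := value_tails (n := (n + l)%N) gc cvx.
apply: (@cvg_unique R (@Rhausdorff R) _ _ _ _ v2) => //.
rewrite (_ : (fun i => c (n + l + i)%N) = (fun i => c (n + i)%N)) //.
by apply/funext => i; rewrite addnAC periodic // (leq_trans len) // leq_addr.
Qed.

Variable R : realType.
Variables (a h b : int) (alpha beta : R).
Hypothesis a_neq0 : a != 0.
Hypothesis sum_roots : a%:~R * (alpha + beta) = - h%:~R.
Hypothesis prod_roots : a%:~R * (alpha * beta) = b%:~R.
Hypotheses (ia : irr alpha) (ib : irr beta).

(** [u] and [ubar] are conjugate in the quadratic field of [alpha]; the common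
    denominator [r] avoids fractions. *)
Definition conjugate (u ubar : R) := exists p q r : int,
  [/\ r != 0, r%:~R * u = p%:~R + q%:~R * alpha &
      r%:~R * ubar = p%:~R + q%:~R * beta].

Lemma conjugate_roots : conjugate alpha beta.
Proof. by exists 0, 1, 1; split=> //; ring. Qed.

Lemma conjugate_sub u ubar (n : nat) :
  conjugate u ubar -> conjugate (u - n%:R) (ubar - n%:R).
Proof.
move=> [p [q [r [r0 e eb]]]]; exists (p - r * n%:Z), q, r; split=> //.
  by rewrite mulrBr e intrB intrM -pmulrn; ring.
by rewrite mulrBr eb intrB intrM -pmulrn; ring.
Qed.

(** The new denominator is the norm of p + q alpha, multiplied by [a]. *)
Lemma conjugate_inv u ubar : u != 0 -> ubar != 0 ->
  conjugate u ubar -> conjugate u^-1 ubar^-1.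
Proof.
move=> u0 ub0 [p [q [r [r0 e eb]]]].
have rR : r%:~R != 0 :> R by rewrite intr_eq0.
have aR : a%:~R != 0 :> R by rewrite intr_eq0.
have nE : (a * p ^+ 2 - h * p * q + b * q ^+ 2)%:~R =
    a%:~R * (p%:~R + q%:~R * alpha) * (p%:~R + q%:~R * beta) :> R.
  rewrite !(intrD, intrB, intrN, intrM) -prod_roots -(opprK (h%:~R : R)) -sum_roots.
  by rewrite -?exprnP ?rmorphXn /=; ring.
exists (r * (a * p - h * q)), (- (r * q * a)), (a * p ^+ 2 - h * p * q + b * q ^+ 2).
split.
- by rewrite -(intr_eq0 R) nE -e -eb !mulf_neq0.
- rewrite nE -e -eb !(intrM, intrN, intrB) -(opprK (h%:~R : R)) -sum_roots.
  transitivity (a%:~R * r%:~R * (r%:~R * ubar)); first by field.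
  by rewrite eb; ring.
- rewrite nE -e -eb !(intrM, intrN, intrB) -(opprK (h%:~R : R)) -sum_roots.
  transitivity (a%:~R * r%:~R * (r%:~R * u)); first by field.
  by rewrite e; ring.
Qed.

Lemma conjugate_inj u ubar vbar : conjugate u ubar -> conjugate u vbar -> ubar = vbar.
Proof.
move=> [p [q [r [r0 e eb]]]] [p' [q' [r' [r'0 e' eb']]]].
have rR : r%:~R != 0 :> R by rewrite intr_eq0.
have r'R : r'%:~R != 0 :> R by rewrite intr_eq0.
have key : (r' * p - r * p')%:~R = (r * q' - r' * q)%:~R * alpha.
  have : r'%:~R * (r%:~R * u) = r%:~R * (r'%:~R * u) by ring.
  by rewrite e e' !(intrB, intrM) => hh; lra.
have [h1 h2] := irr_eq0 ia key.
apply: (mulfI (mulf_neq0 rR r'R)).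
have -> : r%:~R * r'%:~R * ubar = r'%:~R * (r%:~R * ubar) by ring.
have -> : r%:~R * r'%:~R * vbar = r%:~R * (r'%:~R * vbar) by ring.
rewrite eb eb' !mulrDr !mulrA -!intrM.
have -> : r' * p = r * p' by apply/eqP; rewrite -subr_eq0 h1.
have -> // : r' * q = r * q'.
by apply/esym/eqP; rewrite -subr_eq0 h2.
Qed.

Lemma tails_conjugate c n : conjugate (tails c alpha n) (tails c beta n).
Proof.
elim: n => [|n IH] /=; first exact: conjugate_roots.
apply: conjugate_inv; last exact: conjugate_sub.
  exact/irr_neq0/irr_sub/tails_irr.
exact/irr_neq0/irr_sub/tails_irr.
Qed.

Variables (c : nat -> nat) (K l : nat).
Hypothesis gc : genuine c.
Hypothesis cva : cf_value c alpha.
Hypothesis periodic : forall i, (K <= i)%N -> c (i + l)%N = c i.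

(** An equality between complete quotients of [alpha] is inherited by their
    conjugates. *)
Lemma conj_tails_periodic n : (K <= n)%N -> tails c beta (n + l) = tails c beta n.
Proof.
move=> len; apply: (conjugate_inj (u := tails c alpha n)).
  by rewrite -(tails_periodic gc cva periodic) //; apply: tails_conjugate.
exact: tails_conjugate.
Qed.

Hypotheses (alpha_neq_beta : alpha != beta) (l_gt0 : (0 < l)%N).

(** If no conjugate were negative, all would be positive by irrationality;
    they would be complete quotients of [beta] for the expansion of [alpha],
    and [beta = alpha].  From a negative one on, all are negative, and
    periodicity carries this back to index [K]. *)
Lemma conj_tails_lt0 n : (K <= n)%N -> tails c beta n < 0.
Proof.
move=> len.
have [m hm] : exists m, tails c beta m < 0.
  have [//|none] := pselect (exists m, tails c beta m < 0).
  case/negP: alpha_neq_beta; apply/eqP.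
  apply: (@cvg_unique R (@Rhausdorff R) _ _ _ _ cva).
  apply: (@quotients_value _ _ _ (tails c beta) 1%N) => //.
    apply: tailsP => m; have := irr_neq0 (@tails_irr _ c _ m ib).
    case: ltrgtP => // hm _; by case: none; exists m.
  by case=> // i _; apply: gc.
have later i : tails c beta (m + i) < 0.
  elim: i => [|i IH]; first by rewrite addn0.
  rewrite addnS /= invr_lt0 subr_lt0; apply: lt_le_trans IH _; exact: ler0n.
have shift i : tails c beta (n + i * l) = tails c beta n.
  elim: i => [|i IH]; first by rewrite mul0n addn0.
  by rewrite mulSn (addnC l) addnA conj_tails_periodic //; lia.
rewrite -(shift m) (_ : (n + m * l = m + (n + m * l - m))%N) ?later //.
by nia.
Qed.

End Conjugates.

(** * Periodic functions on the integers *)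

Section Extension.

Lemma periodic_mul (T : Type) (F : int -> T) (l : nat) :
  (forall j, F (j + l%:Z) = F j) ->
  forall j (p : nat), F (j + p%:Z * l%:Z) = F j.
Proof.
move=> per j; elim=> [|p IH]; first by rewrite mul0r addr0.
rewrite (_ : _ + _ = j + p%:Z * l%:Z + l%:Z) ?per //.
by rewrite intS; ring.
Qed.

(** Any representative of [j] modulo [l] that is at least 1 could serve; adding
    [(|j| + 1) * l] to [j] gives one. *)
Lemma int_extension (T : Type) (f : nat -> T) (l : nat) : (0 < l)%N ->
  (forall n, f (n.+1 + l)%N = f n.+1) ->
  exists2 F : int -> T, forall j, F (j + l%:Z) = F j &
                        forall n : nat, F n.+1%:Z = f n.+1.
Proof.
move=> l0 per.
have perM n p : f (n.+1 + p * l)%N = f n.+1.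
  elim: p => [|p IH]; first by rewrite mul0n addn0.
  by rewrite mulSn (addnC l) addnA addSn per.
have cong n m i i' : (n.+1 + i * l = m.+1 + i' * l)%N -> f n.+1 = f m.+1.
  by move=> e; rewrite -(perM n i) e perM.
pose idx (j : int) := `|(j + (`|j|%N.+1)%:Z * l%:Z)%R|%N.
have idxE j : exists2 n, idx j = n.+1 & n.+1%:Z = j + (`|j|%N.+1)%:Z * l%:Z.
  have pos : 0 < j + (`|j|%N.+1)%:Z * l%:Z by nia.
  by exists (idx j).-1; rewrite /idx; lia.
exists (fun j => f (idx j)).
  move=> j; have [n -> nE] := idxE (j + l%:Z); have [m -> mE] := idxE j.
  apply: (@cong _ _ (`|j|%N.+1) (`|(j + l%:Z)%R|%N.+2)).
  by move: nE mE; move: `|_|%N `|_|%N => q p; nia.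
move=> n; have [m -> mE] := idxE n.+1%:Z.
by apply: (@cong _ _ 0%N n.+2); move: mE; rewrite /=; nia.
Qed.

End Extension.

(** * Splicing expansions *)

Section Prepend.
Variable R : realType.
Implicit Types (c tail : nat -> nat) (y : R) (pre s : seq nat).

Definition expands c y := exists xs, complete_quotients c y xs.

Lemma expands_gt0 c y : expands c y -> 0 < y.
Proof. by case=> xs /quotients_pos. Qed.

Lemma expands_cons pre tail n y : expands (cf_seq pre tail) y ->
  0 < n%:R + y^-1 -> expands (cf_seq (n :: pre) tail) (n%:R + y^-1).
Proof.
move=> [xs [<- xpos xrec]] pos.
exists (fun i => if i is j.+1 then xs j else n%:R + (xs 0%N)^-1).
by split=> [|[|i]|[|i]] //; rewrite xrec.
Qed.

Lemma expands_tails c pre tail y n : expands (cf_seq pre tail) (tails c y n) ->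
  expands (cf_seq (mkseq c n ++ pre) tail) y.
Proof.
elim: n pre => [|n IH] pre ex; first exact: ex.
rewrite mkseqSr cat_rcons; apply: IH; rewrite tails_rec.
apply: expands_cons => //.
by apply: ltr_wpDl; rewrite ?ler0n // invr_gt0 (expands_gt0 ex).
Qed.

Lemma cf_seq_nil tail : cf_seq [::] tail = tail.
Proof. by apply/funext => i; rewrite /cf_seq /= subn0. Qed.

Lemma expands_value pre tail y : irr y -> (forall i, 0 < tail i)%N ->
  expands (cf_seq pre tail) y -> cf_value (cf_seq pre tail) y.
Proof.
move=> iy tpos [xs cq]; apply: (quotients_value (m := size pre) iy cq) => i lei.
by rewrite /cf_seq ifN ?tpos // -leqNgt.
Qed.

Lemma expands_describes c y : expands c y -> describes c (gamma y).
Proof. by case=> xs /quotients_describe. Qed.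

Lemma mkseq_cf_seq s pre tail : mkseq (cf_seq (s ++ pre) tail) (size s) = s.
Proof.
apply: (@eq_from_nth _ 0%N); first by rewrite size_mkseq.
move=> i; rewrite size_mkseq => lti; rewrite nth_mkseq // /cf_seq size_cat.
by rewrite ltn_addr // nth_cat lti.
Qed.

(** After the common blocks and [i] further turns, the path of [y] goes on with
    the same turn, since [i < c n], whereas the entry 1 makes the path of [z]
    turn the other way. *)
Lemma branching_split c y z n i pre tail :
  expands c y -> (i < c n)%N ->
  expands (cf_seq (mkseq c n ++ [:: i, 1 & pre]%N) tail) z ->
  let s := mkseq c n ++ [:: i] in
  split_at y z (size (cf_word s)) /\
  cf_path s = mkseq (gamma y) (size (cf_word s)).+1.
Proof.
move=> [xs cq] lti [zs cq'] s.
have sE : s = rcons (mkseq c n) i by rewrite /s cats1.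
have sizes : size s = n.+1 by rewrite sE size_rcons size_mkseq.
have fy : followed y (rcons (cf_word s) (odd n)).
  have := quotients_followed cq n.+1.
  rewrite mkseqSr sE !cf_word_rcons size_mkseq -cats1 -catA.
  have -> : c n = (i + (1 + (c n - i.+1)))%N by lia.
  by rewrite !nseqD !catA; exact: followed_cat.
have fz : followed z (rcons (cf_word s) (~~ odd n)).
  have := quotients_followed cq' n.+2.
  have -> : mkseq (cf_seq (mkseq c n ++ [:: i, 1 & pre]%N) tail) n.+2 = rcons s 1%N.
    have e : n.+2 = size (rcons s 1%N) by rewrite size_rcons sizes.
    rewrite e (_ : mkseq c n ++ _ = rcons s 1%N ++ pre) ?mkseq_cf_seq //.
    by rewrite cat_rcons sE cat_rcons.
  by rewrite cf_word_rcons sizes cats1.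
split; first exact: split_words fy fz.
by apply: cf_path_gamma; move: fy; rewrite -cats1; exact: followed_cat.
Qed.

End Prepend.

(** * The roots of the form *)

Section FormRoots.
Variables (R : realType) (a h b : int).
Let Q := qform a h b.
Let alpha := root_plus R a h b.
Let beta := root_minus R a h b.
Hypothesis indef : indefinite Q.
Hypothesis nz : forall v : vec, v != 0 -> Q v != 0.
Hypothesis a0 : 0 < a.

Lemma disc_gt0 : 0 < disc a h b.
Proof.
have [_ [v neg]] := indef; rewrite /Q /qform in neg.
have : 4 * a * (a * v 0 0 ^+ 2 + h * v 0 0 * v 1 0 + b * v 1 0 ^+ 2) < 0.
  by rewrite pmulr_rlt0 // mulr_gt0.
rewrite (_ : _ * _ = (2 * a * v 0 0 + h * v 1 0) ^+ 2 - disc a h b * v 1 0 ^+ 2); last first.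
  by rewrite /disc; ring.
have := sqr_ge0 (2 * a * v 0 0 + h * v 1 0); have := sqr_ge0 (v 1 0).
set x := _ ^+ 2; set y := (2 * _ * _ + _) ^+ 2 => x_ge0 y_ge0 lt0.
rewrite ltNge; apply/negP => D0; have : disc a h b * x <= 0 by rewrite mulr_le0_ge0.
by lia.
Qed.

Let aR : 0 < a%:~R :> R. Proof. by rewrite ltr0z. Qed.
Let w : R := Num.sqrt (disc a h b)%:~R.
Let w2 : w ^+ 2 = h%:~R ^+ 2 - 4 * a%:~R * b%:~R.
Proof.
rewrite sqr_sqrtr ?ler0z ?(ltW disc_gt0) // /disc.
by rewrite intrB !intrM.
Qed.
Let w_gt0 : 0 < w. Proof. by rewrite sqrtr_gt0 ltr0z disc_gt0. Qed.

Lemma sum_roots : a%:~R * (alpha + beta) = - h%:~R.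
Proof.
rewrite /alpha /beta /root_plus /root_minus -/w intrN; field.
by rewrite gt_eqF.
Qed.

Lemma prod_roots : a%:~R * (alpha * beta) = b%:~R.
Proof.
have -> : alpha * beta = (h%:~R ^+ 2 - w ^+ 2) / (4 * a%:~R ^+ 2).
  rewrite /alpha /beta /root_plus /root_minus -/w intrN; field.
  by rewrite gt_eqF.
by rewrite w2; field; rewrite gt_eqF.
Qed.

Lemma form_factors v : (Q v)%:~R =
  a%:~R * (((v 0 0)%:~R - (v 1 0)%:~R * alpha) * ((v 0 0)%:~R - (v 1 0)%:~R * beta)).
Proof.
rewrite /Q /qform !(intrD, intrM) -prod_roots -(opprK (h%:~R : R)) -sum_roots.
by ring.
Qed.

Lemma form_swap v : (Q v)%:~R =
  a%:~R * (((v 0 0)%:~R - (v 1 0)%:~R * beta) * ((v 0 0)%:~R - (v 1 0)%:~R * alpha)).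
Proof. by rewrite form_factors; ring. Qed.

(** If [y = p / q] then [Q] vanishes at (p, q). *)
Lemma root_irr y :
  (forall v, exists z : R, (Q v)%:~R = ((v 0 0)%:~R - (v 1 0)%:~R * y) * z) -> irr y.
Proof.
move=> fac p q e.
pose v : vec := \col_i (if i == 0 then p else q).
have [z] := fac v; rewrite !mxE /= e subrr mul0r => /eqP; rewrite intr_eq0 => Q0.
have v0 : v = 0 by apply: contraTeq Q0; apply: nz.
by have := congr1 (fun u : vec => u 1 0) v0; rewrite !mxE.
Qed.

Lemma alpha_irr : irr alpha.
Proof. by apply: root_irr => v; eexists; rewrite form_factors mulrCA. Qed.

Lemma beta_irr : irr beta.
Proof. by apply: root_irr => v; eexists; rewrite form_swap mulrCA. Qed.

Lemma beta_lt_alpha : beta < alpha.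
Proof.
rewrite /alpha /beta /root_plus /root_minus -/w ltr_pM2r ?invr_gt0 ?mulr_gt0 //.
by have := w_gt0; lra.
Qed.

Hypotheses (b0 : 0 < b) (h0 : h < 0).

(** Here the discriminant is smaller than [h ^+ 2]. *)
Lemma beta_gt0 : 0 < beta.
Proof.
rewrite /beta /root_minus -/w divr_gt0 ?mulr_gt0 //.
have hR : h%:~R < 0 :> R by rewrite ltrz0.
have bR : 0 < b%:~R :> R by rewrite ltr0z.
have : w ^+ 2 < (- h%:~R) ^+ 2 by rewrite w2 sqrrN gtrBl !mulr_gt0.
have hN : 0 <= - h%:~R :> R by lra.
by rewrite ltr_pXn2r ?nnegrE ?(ltW w_gt0) // intrN subr_gt0.
Qed.

End FormRoots.

(** * The expansion of the conjugate root *)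

Section ConjugateExpansion.
Variables (R : realType) (beta : R).
Variables (k : nat) (ca : nat -> nat) (cb : int -> nat).
Let c := cf_seq (mkseq ca k.+1) (fun i => cb (i%:Z + 1)).

Lemma expansion_pre i : (i <= k)%N -> c i = ca i.
Proof. by move=> lei; rewrite /c /cf_seq size_mkseq ltnS lei nth_mkseq. Qed.

Lemma expansion_tail n : c (k + n.+1)%N = cb n.+1%:Z.
Proof.
rewrite /c /cf_seq size_mkseq ltnNge (_ : (k < k + n.+1)%N) /=; last by lia.
by congr cb; lia.
Qed.

Lemma mkseq_expansion n : (n <= k.+1)%N -> mkseq c n = mkseq ca n.
Proof.
move=> len; apply/eq_in_map => i; rewrite mem_iota => /andP[_ lti].
by apply: expansion_pre; lia.
Qed.

Lemma expands_reversed (phi : int -> R) j :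
  (forall j, phi j = (cb (j - 1))%:R + (phi (j - 1))^-1) -> (forall j, 0 < phi j) ->
  expands (cf_seq [::] (fun i => cb (j - 1 - i%:Z))) (phi j).
Proof.
move=> phiS phi0; rewrite cf_seq_nil; exists (fun i => phi (j - i%:Z)).
split=> [|//|i]; first by rewrite subr0.
rewrite phiS (_ : j - i%:Z - 1 = j - 1 - i%:Z); last by ring.
by rewrite (_ : j - i.+1%:Z = j - 1 - i%:Z); last by lia.
Qed.

Variable l : nat.
Hypothesis l_gt0 : (0 < l)%N.
Hypothesis cb_periodic : forall j : int, cb (j + l%:Z) = cb j.
Hypothesis gc : genuine c.

Lemma cb_gt0 j : (0 < cb j)%N.
Proof.
rewrite -(periodic_mul cb_periodic j `|j|%N.+1).
have [n ->] : exists n : nat, j + `|j|%N.+1%:Z * l%:Z = n.+1%:Z.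
  exists (`|(j + `|j|%N.+1%:Z * l%:Z)%R|%N.-1).
  have : 0 < j + `|j|%N.+1%:Z * l%:Z by nia.
  by lia.
by rewrite -expansion_tail addnS; apply: gc.
Qed.

Lemma expansion_periodic i : (k < i)%N -> c (i + l)%N = c i.
Proof.
move=> lti; have [n ->] : exists n, i = (k + n.+1)%N by exists (i - k).-1; lia.
rewrite -addnA addSn !expansion_tail -(cb_periodic n.+1%:Z).
by congr cb; lia.
Qed.

Hypothesis conj_neg : forall n, (k < n)%N -> tails c beta n < 0.
Hypothesis conj_per : forall n, (k < n)%N -> tails c beta (n + l) = tails c beta n.

Lemma periodic_tails (y : R) :
  (forall n, (k < n)%N -> tails c y (n + l) = tails c y n) ->
  exists theta : int -> R,
  [/\ forall j, theta j = (cb j)%:R + (theta (j + 1))^-1,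
      forall n : nat, theta n.+1%:Z = tails c y (k + n.+1),
      forall j, theta (j + l%:Z) = theta j &
      forall j, exists2 n, (k < n)%N & theta j = tails c y n].
Proof.
move=> per; have [|theta thetaP thetaE] := @int_extension _ (fun n => tails c y (k + n)) l l_gt0.
  by move=> n; rewrite addnA per //; lia.
have shift j : exists n : nat, forall F : int -> R, (forall i, F (i + l%:Z) = F i) ->
    F j = F n.+1%:Z.
  exists (`|(j + `|j|%N.+1%:Z * l%:Z)%R|%N.-1) => F FP.
  rewrite -(periodic_mul FP j `|j|%N.+1); congr F.
  have : 0 < j + `|j|%N.+1%:Z * l%:Z by nia.
  by lia.
exists theta; split=> //.
  move=> j; have [n jn] := shift j.
  apply/eqP; rewrite -subr_eq0; apply/eqP.
  rewrite (jn (fun i => theta i - ((cb i)%:R + (theta (i + 1))^-1))); last first.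
    by move=> i; rewrite thetaP cb_periodic (addrAC i) thetaP.
  rewrite (_ : n.+1%:Z + 1 = n.+2%:Z); last by lia.
  by rewrite !thetaE tails_rec expansion_tail -addnS subrr.
by move=> j; have [n ->] := shift j => //; exists (k + n.+1)%N; [lia|].
Qed.

(** [phi j] is the opposite of the inverse of the conjugate of the [j]-th
    complete quotient in the period; its expansion is the period read
    backwards. *)
Lemma reversed_tails : exists phi : int -> R,
  [/\ forall j, phi j = (cb (j - 1))%:R + (phi (j - 1))^-1,
      forall j, 0 < phi j &
      tails c beta k = (ca k)%:R - (cb l%:Z)%:R - (phi l%:Z)^-1].
Proof.
have [theta [thetaS thetaE thetaP thetaN]] := periodic_tails conj_per.
have neg j : theta j < 0 by have [n lt ->] := thetaN j; apply: conj_neg.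
exists (fun j => - (theta j)^-1); split=> [j|j|].
- have := thetaS (j - 1); rewrite subrK => e.
  by rewrite invrN invrK e; ring.
- by rewrite oppr_gt0 invr_lt0.
- rewrite invrN invrK tails_rec expansion_pre // -addn1 -(thetaE 0%N).
  by have e := thetaS l%:Z; rewrite (addrC l%:Z) thetaP in e; rewrite e; ring.
Qed.

(** The conjugate of the [k]-th complete quotient is [ca k - cb l] minus the
    inverse of [phi l], where [phi l > 1]. *)
Lemma conj_expands_gt : (cb l%:Z < ca k)%N ->
  expands (cf_seq (mkseq ca k ++ [:: ca k - cb l%:Z - 1; 1; cb (l%:Z - 1)%R - 1])%N
                  (fun i => cb (l%:Z - 2 - i%:Z))) beta.
Proof.
have [phi [phiS phi0 tk]] := reversed_tails => lt_ba.
have pinv : 0 < (phi (l%:Z - 1))^-1 by rewrite invr_gt0.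
pose z : R := ((cb (l%:Z - 1)%R - 1)%N)%:R + (phi (l%:Z - 1))^-1.
have z0 : 0 < z by rewrite ltr_wpDl.
have phiE : phi l%:Z = z + 1.
  by rewrite phiS /z natrB ?cb_gt0 //; ring.
have e3 := expands_reversed (l%:Z - 1) phiS phi0.
rewrite (_ : (fun i : nat => cb (l%:Z - 1 - 1 - i%:Z)) =
             (fun i : nat => cb (l%:Z - 2 - i%:Z))) in e3; last first.
  by apply/funext => i; congr cb; lia.
have e2 := expands_cons e3 z0.
have e1 : expands (cf_seq [:: 1; cb (l%:Z - 1)%R - 1]%N
    (fun i => cb (l%:Z - 2 - i%:Z))) (1%:R + z^-1).
  by apply: expands_cons e2 _; rewrite addr_gt0 ?invr_gt0.
rewrite -mkseq_expansion //; apply: expands_tails.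
have -> : tails c beta k = (ca k - cb l%:Z - 1)%N%:R + (1%:R + z^-1)^-1.
  rewrite tk phiE !natrB //; try lia.
  by field; rewrite !gt_eqF //; lra.
by apply: expands_cons e1 _; rewrite ltr_wpDl ?ler0n // invr_gt0 addr_gt0 ?invr_gt0.
Qed.

Hypothesis beta_pos : 0 < beta.

(** Now the conjugate of the [k]-th complete quotient is negative.  As [beta]
    is positive, it is not [beta] itself, so [k > 0]; and the partial quotient
    before it is positive because it must compensate for its negative
    inverse. *)
Lemma conj_expands_lt : (ca k < cb l%:Z)%N -> exists k', [/\ k = k'.+1, (0 < ca k')%N &
  expands (cf_seq (mkseq ca k' ++ [:: ca k' - 1; 1; cb l%:Z - ca k - 1])%N
                  (fun i => cb (l%:Z - 1 - i%:Z))) beta].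
Proof.
have [phi [phiS phi0 tk]] := reversed_tails => lt_ab.
have pinv : 0 < (phi l%:Z)^-1 by rewrite invr_gt0.
have ltR : (ca k)%:R + 1 <= (cb l%:Z)%:R :> R by rewrite natr1 ler_nat.
have [k' kE] : exists k', k = k'.+1.
  case: (k) tk ltR => [|k'] tk ltR; last by exists k'.
  by exfalso; move: beta_pos; rewrite -[beta]/(tails c beta 0) tk; lra.
have cE : c k' = ca k' by apply: expansion_pre; lia.
pose z : R := ((cb l%:Z - ca k - 1)%N)%:R + (phi l%:Z)^-1.
have zE : z = (cb l%:Z)%:R - (ca k)%:R - 1 + (phi l%:Z)^-1.
  by rewrite /z !natrB //; lia.
have z0 : 0 < z by rewrite zE; lra.
have tk' : tails c beta k' = (ca k')%:R - (z + 1)^-1.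
  rewrite tails_rec cE -kE tk; congr (_ + _); rewrite -[RHS]invrN; congr (_^-1).
  by rewrite zE; ring.
have z1 : 0 < (z + 1)^-1 by rewrite invr_gt0; lra.
have ck0 : (0 < ca k')%N.
  rewrite lt0n; apply/eqP => ca0; case: (k') ca0 tk' cE => [|k''] ca0 tk' cE.
    by move: beta_pos; rewrite -[beta]/(tails c beta 0) tk' ca0; lra.
  by have := gc k''; rewrite cE ca0.
exists k'; split=> //.
rewrite -mkseq_expansion; last by lia.
apply: expands_tails.
have e3 := expands_reversed l%:Z phiS phi0.
have e2 := expands_cons e3 z0.
have e1 : expands (cf_seq [:: 1; cb l%:Z - ca k - 1]%N
    (fun i => cb (l%:Z - 1 - i%:Z))) (1%:R + z^-1).
  by apply: expands_cons e2 _; rewrite addr_gt0 ?invr_gt0.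
have -> : tails c beta k' = (ca k' - 1)%N%:R + (1%:R + z^-1)^-1.
  by rewrite tk' natrB //; field; rewrite !gt_eqF //; lra.
apply: expands_cons e1 _; rewrite ltr_wpDl ?ler0n // invr_gt0 addr_gt0 ?invr_gt0 //.
Qed.

End ConjugateExpansion.

End Theory.

(* ca i is a_i (i <= k) and cb j is b_j, extended to all integers j with period
   l. The subtractions of naturals inside the expansions never truncate. *)
Theorem proposition3 (R : realType) (a h b : int)
    (k l : nat) (ca : nat -> nat) (cb : int -> nat) :
  let Q := qform a h b in
  let alpha := root_plus R a h b in
  let alphabar := root_minus R a h b in
  let expansion := cf_seq (mkseq ca k.+1) (fun i => cb (i%:Z + 1)) in
  indefinite Q ->
  (forall v : vec, v != 0 -> Q v != 0) ->
  0 < a -> 0 < b -> 0 < a + b + h -> h < 0 ->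
  (0 < l)%N ->
  (forall j : int, cb (j + l%:Z) = cb j) ->
  genuine expansion ->
  cf_value expansion alpha ->
  ca k <> cb l%:Z ->
  exists P Pbar : nat -> set (set vec),
  [/\ (* (i), for alpha *)
      [/\ is_gamma alpha P, describes expansion P, river_path Q alpha P &
          forall P', river_path Q alpha P' -> P' = P],
      (* (i), for the other root *)
      [/\ [/\ is_gamma alphabar Pbar, river_path Q alphabar Pbar &
              forall P', river_path Q alphabar P' -> P' = Pbar],
          ((1 <= k)%N -> (ca k < cb l%:Z)%N ->
            let c := cf_seq
              (mkseq ca k.-1 ++ [:: ca k.-1 - 1; 1; cb l%:Z - ca k - 1])%N
              (fun i => cb (l%:Z - 1 - i%:Z)) in
            [/\ (0 < ca k.-1)%N, cf_value c alphabar & describes c Pbar]),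
          ((cb l%:Z < ca k)%N ->
            let c := cf_seq
              (mkseq ca k ++ [:: ca k - cb l%:Z - 1; 1; cb (l%:Z - 1)%R - 1])%N
              (fun i => cb (l%:Z - 2 - i%:Z)) in
            cf_value c alphabar /\ describes c Pbar) &
          (k = 0%N -> (ca 0 < cb l%:Z)%N ->
            cf_value (cf_seq [:: (cb l%:Z - ca 0)%N]
                             (fun i => cb (l%:Z - 1 - i%:Z)))
                     (- alphabar))],
      (* (ii) *)
      exists (M : int -> 'M[int]_2) (t : int -> bool),
        [/\ oriented_path M t,
            river Q = [set edge_of (M n) | n in setT],
            leads_to (fun n => end_vertex (M n%:Z)) alpha,
            leads_to (fun n => end_vertex (M (- n%:Z))) alphabar &
            turn_blocks t cb] &
      (* (iii) *)
      [/\ ((1 <= k)%N -> (cb l%:Z < ca k)%N ->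
            part_to_river Q P
              (cf_path (mkseq ca k ++ [:: ca k - cb l%:Z - 1])%N)),
          ((1 <= k)%N -> (ca k < cb l%:Z)%N ->
            part_to_river Q P
              (cf_path (mkseq ca k.-1 ++ [:: ca k.-1 - 1])%N)),
          (k = 0%N -> (cb l%:Z < ca 0)%N ->
            part_to_river Q P (cf_path [:: (ca 0 - cb l%:Z - 1)%N])) &
          (k = 0%N -> (ca 0 < cb l%:Z)%N ->
            part_to_river Q P (cf_path [::]))]].
Proof.
move=> Q alpha alphabar c indef nz a0 b0 sum0 h0 l0 cbP gc cva ne.
have ia : irr alpha := alpha_irr indef nz a0.
have ib : irr alphabar := beta_irr indef nz a0.
have beta0 : 0 < alphabar := beta_gt0 R indef a0 b0 h0.
have ltba : alphabar < alpha := beta_lt_alpha R indef a0.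
have alpha0 : 0 < alpha := lt_trans beta0 ltba.
have aR : 0 < a%:~R :> R by rewrite ltr0z.
have neq : alpha != alphabar by rewrite gt_eqF.
have QE := form_factors R indef a0; rewrite -/Q -/alpha -/alphabar in QE.
have QE' := form_swap R indef a0; rewrite -/Q -/alpha -/alphabar in QE'.
have sumE := sum_roots R h b a0; rewrite -/alpha -/alphabar in sumE.
have prodE := prod_roots R indef a0; rewrite -/alpha -/alphabar in prodE.
have an0 : a != 0 by rewrite gt_eqF.
have cper i : (k < i)%N -> c (i + l)%N = c i by apply: expansion_periodic.
have tper n : (k < n)%N -> tails c alpha (n + l) = tails c alpha n.
  exact: (tails_periodic gc cva cper).
have ctper n : (k < n)%N -> tails c alphabar (n + l) = tails c alphabar n.
  exact: (conj_tails_periodic an0 sumE prodE ia ib gc cva cper).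
have cneg n : (k < n)%N -> tails c alphabar n < 0.
  exact: (conj_tails_lt0 an0 sumE prodE ia ib gc cva cper neq l0).
have exa : expands c alpha.
  by exists (tails c alpha); apply: value_quotients.
have [N splitN] := split_exists ia ib alpha0 beta0 neq.
have cpre i : (i <= k)%N -> c i = ca i by exact: expansion_pre.
have mkpre n : (n <= k.+1)%N -> mkseq c n = mkseq ca n by exact: mkseq_expansion.
have cbpos := cb_gt0 l0 cbP gc.
have entry n i pre tail : (i < c n)%N ->
    expands (cf_seq (mkseq c n ++ [:: i, 1 & pre]%N) tail) alphabar ->
    part_to_river Q (gamma alpha) (cf_path (mkseq c n ++ [:: i])).
  move=> lti ex; have [sp ->] := branching_split exa lti ex.
  exact: (gamma_part_to_river aR QE).
exists (gamma alpha), (gamma alphabar); split.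
- split.
  + exists c; split=> //; exact: expands_describes.
  + exact: expands_describes.
  + exact: (gamma_river_path aR QE ia ib alpha0 beta0 splitN).
  + by move=> P [tP P0 lead _]; apply: gamma_unique.
- split.
  + split.
    * have [c' gc' cq] := genuine_expansion ib beta0; exists c'; split=> //.
        by apply: (quotients_value (m := 1%N) ib cq) => -[].
      exact: quotients_describe cq.
    * exact: (gamma_river_path aR QE' ib ia beta0 alpha0 (split_atC splitN)).
    * by move=> P [tP P0 lead _]; apply: gamma_unique.
  + move=> _ lt c'; have [k' [kE ck0 ex]] := conj_expands_lt l0 cbP gc cneg ctper beta0 lt.
    rewrite /c' {c'}; have -> : k.-1 = k' by rewrite kE.
    split=> //; last exact: expands_describes.
    exact: expands_value.
  + move=> lt c'; have ex := conj_expands_gt l0 cbP gc cneg ctper lt.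
    by split; [exact: expands_value|exact: expands_describes].
  + move=> k0 lt; have lt' : (ca k < cb l%:Z)%N by rewrite k0.
    have [k' [kE _ _]] := conj_expands_lt l0 cbP gc cneg ctper beta0 lt'.
    by rewrite k0 in kE.
- have [theta [thetaS thetaE _ thetaN]] := periodic_tails l0 cbP tper.
  have [thetabar [thetabarS thetabarE _ thetabarN]] := periodic_tails l0 cbP ctper.
  have theta_gt0 j : 0 < theta j.
    have [n _ ->] := thetaN j; have [_ pos _] := value_quotients gc cva; exact: pos.
  have thetabar_lt0 j : thetabar j < 0.
    by have [n lt ->] := thetabarN j; apply: cneg.
  pose w := cf_word (mkseq c k.+1).
  have wE : euclid alpha (size w) = mx_of w.
    have [xs cq] := exa; have fol := quotients_followed cq k.+1.
    by rewrite -(followed_euclid fol (leqnn _)) take_size.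
  have q1 : quotient_at (odd k.+1) (euclid alpha (size w)) alpha (theta 1).
    rewrite wE (thetaE 0%N) addn1; apply: quotient_expansion => // i.
      exact: tails_rec.
    exact/irr_neq0/tails_irr.
  have q2 : quotient_at (odd k.+1) (euclid alpha (size w)) alphabar (thetabar 1).
    rewrite wE (thetabarE 0%N) addn1; apply: quotient_expansion => // i.
      exact: tails_rec.
    exact/irr_neq0/tails_irr.
  have [M [t [dM sM fM blocks]]] :=
    bi_infinite_path ia ib alpha0 cbpos thetaS thetabarS theta_gt0 thetabar_lt0 q1 q2.
  exists M, t; split=> //.
  + by move=> n; split; [have [] := dM n|].
  + exact: (river_edges ia alpha0 dM sM fM aR QE).
  + move=> eps eps0; have [n1 _ near_n] := gamma_leads_to ia alpha0 eps0.
    exists n1 => // n /= len v; rewrite fM; apply: near_n => /=.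
    exact: leq_trans (leq_addl _ _).
  + exact: (upstream_leads_to ia alpha0 dM sM fM ib beta0 splitN).
- have gt_part : (cb l%:Z < ca k)%N ->
      part_to_river Q (gamma alpha) (cf_path (mkseq ca k ++ [:: ca k - cb l%:Z - 1])%N).
    move=> lt; have ex := conj_expands_gt l0 cbP gc cneg ctper lt.
    have mkE : mkseq c k = mkseq ca k by apply: mkpre.
    rewrite -mkE; apply: (entry _ _ [:: (cb (l%:Z - 1)%R - 1)%N]
      (fun i => cb (l%:Z - 2 - i%:Z))); last by rewrite mkE.
    by rewrite cpre //; lia.
  split.
  + by move=> _; exact: gt_part.
  + move=> _ lt; have [k' [kE ck0 ex]] := conj_expands_lt l0 cbP gc cneg ctper beta0 lt.
    have -> : k.-1 = k' by rewrite kE.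
    have lek : (k' <= k.+1)%N by rewrite kE (leqW (leqnSn k')).
    have mkE : mkseq c k' = mkseq ca k' by apply: mkpre.
    rewrite -mkE; apply: (entry _ _ [:: (cb l%:Z - ca k - 1)%N]
      (fun i => cb (l%:Z - 1 - i%:Z))); last by rewrite mkE.
    by rewrite cpre ?kE //; lia.
  + by move=> k0 lt; have := gt_part; rewrite k0 => /(_ lt).
  + move=> k0 lt; have lt' : (ca k < cb l%:Z)%N by rewrite k0.
    have [k' [kE _ _]] := conj_expands_lt l0 cbP gc cneg ctper beta0 lt'.
    by rewrite k0 in kE.
Qed.
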